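(* Let $k\ge3$. On a cuboid cell $T$ let $\boldsymbol\Xi_T$ be the space of traceless matrix fields $\boldsymbol\tau$ with $\tau_{ii}\in\mathcal Q_{k-1,k-1,k-1}$ for each $i$, and $\tau_{ij}\in\mathcal Q(i{:}k-2,j{:}k,l{:}k-1)$ for $i\neq j$. The following degrees of freedom are unisolvent for $\boldsymbol\Xi_T$. For two of the three diagonal entries $\tau_{ii}$ (the third being determined by tracelessness): (a) the value of $\tau_{ii}$ at each vertex; (b) moments of $\tau_{ii}$ on each edge against polynomials of degree $\le k-3$ in the edge variable; (c) moments of $\tau_{ii}$ on each face against polynomials of degree $\le k-3$ in each of the two face variables; (d) moments of $\tau_{ii}$ on $T$ against $\mathcal Q_{k-3,k-3,k-3}$. For each off-diagonal entry $\tau_{ij}$, $i\ne j$: (a) moments of $\tau_{ij},\partial_j\tau_{ij}$ on each edge $e_i$ against $\mathcal Q(i{:}k-2)$; (b) moments of $\tau_{ij}$ on each face $F_{ij}$ against $\mathcal Q(i{:}k-2,j{:}k-4)$; (c) moments of $\tau_{ij},\partial_j\tau_{ij}$ on each face $F_{il}$ against $\mathcal Q(i{:}k-2,l{:}k-3)$; (d) moments of $\tau_{ij}$ on $T$ against $\mathcal Q(i{:}k-2,j{:}k-4,l{:}k-3)$. Moreover, the resulting finite element space $\boldsymbol\Xi_h$ on $\mathcal T_h$ is $\boldsymbol H(\operatorname{div};\mathbb T)$ conforming, i.e. $\boldsymbol\Xi_h\subset\boldsymbol H(\operatorname{div},\Omega;\mathbb T)$.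
   Context: Coordinates are $(x_1,x_2,x_3)=(x,y,z)$, $\partial_i=\partial/\partial x_i$. Whenever indices $i,j,l$ occur together they are pairwise distinct, i.e. $\{i,j,l\}=\{1,2,3\}$. $\mathcal Q(i{:}a,j{:}b,l{:}c)$ is the space of polynomials of degree at most $a$ in $x_i$, at most $b$ in $x_j$ and at most $c$ in $x_l$ (separately); similarly with fewer variables on faces and edges; it is the zero space if some bound is negative (the corresponding degrees of freedom are then absent). $\mathcal Q_{a,b,c}=\mathcal Q(1{:}a,2{:}b,3{:}c)$. $\mathbb T$ is the space of traceless real $3\times3$ matrices; $\operatorname{div}$ acts row-wise on matrix fields; $\boldsymbol H(\operatorname{div},\Omega;\mathbb T)=\{\boldsymbol v\in L^2(\Omega;\mathbb T):\operatorname{div}\boldsymbol v\in L^2(\Omega;\mathbb R^3)\}$. $\Omega\subset\mathbb R^3$ is a contractible domain with Lipschitz boundary, partitioned by a (face-to-face) mesh $\mathcal T_h$ of axis-parallel cuboids. $e_i$ denotes an edge parallel to the $x_i$-axis; $F_{ij}=F_{ji}$ denotes a face parallel to the $x_i$- and $x_j$-axes. ''Moments of $f$ on $G$ against $P$'' means the functionals $\int_G f\,p$, $p\in P$ (with $p$ running over a basis of $P$ when counting). Degrees of freedom are unisolvent for a shape function space if they form a basis of its dual space. The resulting finite element space consists of all fields on $\Omega$ whose restriction to each cell is in the shape function space and such that each degree of freedom attached to a vertex, edge or face has the same value from all cells containing that vertex, edge or face. *)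

(* Defs.v *)
From mathcomp Require Import all_boot all_order all_algebra.
From mathcomp Require Import all_classical all_reals all_analysis.
(* The notations of mpoly.v clash with those of MathComp-Analysis. *)
From mathcomp Require mpoly.
Export (canonicals, coercions) mpoly.

Set Implicit Arguments.
Unset Strict Implicit.
Unset Printing Implicit Defensive.

Import Order.TTheory GRing.Theory Num.Theory.
Import numFieldNormedType.Exports.

Local Open Scope classical_set_scope.
Local Open Scope ring_scope.

Notation poly3 R := (mpoly.mpoly 3 R).
Notation R3 R := (R * R * R)%type.

Definition axis_x : 'I_3 := @Ordinal 3 0 isT.
Definition axis_y : 'I_3 := @Ordinal 3 1 isT.
Definition axis_z : 'I_3 := @Ordinal 3 2 isT.

Definition coord3 (R : Type) (x : R3 R) (r : 'I_3) : R :=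
  if r == axis_x then x.1.1 else if r == axis_y then x.1.2 else x.2.

Definition peval (R : realType) (p : poly3 R) (x : R3 R) : R :=
  mpoly.meval (coord3 x) p.

(* Q(1:d 0, 2:d 1, 3:d 2).  The bounds are integers, so that a negative bound
   gives the zero space. *)
Definition Qspace (R : realType) (d : 'I_3 -> int) : set (poly3 R) :=
  [set p : poly3 R | forall mu, mu \in mpoly.msupp p ->
     forall r, Posz (mu r) <= d r].

Definition is_basis (R : realType) (V : lmodType R) (E : set V) (b : seq V) :=
  (forall u, u \in b -> E u) /\
  (forall u, E u ->
     exists! c : 'rV[R]_(size b), u = \sum_(t < size b) c 0 t *: b`_t).

Definition linear_on (R : realType) (Xi : set 'M[poly3 R]_3)
    (phi : 'M[poly3 R]_3 -> R) :=
  forall (c : R) s t, Xi s -> Xi t ->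
    phi (map_mx (GRing.scale c) s + t) = c * phi s + phi t.

(* L restricts to a basis of the dual space of Xi. *)
Definition unisolvent (R : realType) (Xi : set 'M[poly3 R]_3)
    (L : seq ('M[poly3 R]_3 -> R)) :=
  let ell t := nth (fun=> 0) L t in
  (forall t, (t < size L)%N -> linear_on Xi (ell t)) /\
  (forall phi, linear_on Xi phi ->
     exists! c : 'rV[R]_(size L), forall tau, Xi tau ->
       phi tau = \sum_(t < size L) c 0 t * ell t tau).

Record cuboid (R : realType) := Cuboid {
  lo : 'I_3 -> R;
  hi : 'I_3 -> R;
  lo_lt_hi : forall r, lo r < hi r }.

(* The 27 vertices, edges, faces and the cell itself, in reference form: along
   each axis the subentity either spans the whole side (None) or sits at its
   lower (Some false) or upper (Some true) end. *)
Definition subent := {ffun 'I_3 -> option bool}.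

Definition is_free (s : subent) (r : 'I_3) : bool := s r == None.
Definition is_vertex (s : subent) := [forall r, ~~ is_free s r].
Definition is_edge (i : 'I_3) (s : subent) :=
  [forall r, is_free s r == (r == i)].
Definition is_face (i j : 'I_3) (s : subent) :=
  [forall r, is_free s r == ((r == i) || (r == j))].
Definition is_cell (s : subent) := [forall r, is_free s r].

Definition endpoint (R : realType) (T : cuboid R) (r : 'I_3) (b : bool) : R :=
  if b then hi T r else lo T r.

Definition subent_set (R : realType) (T : cuboid R) (s : subent)
  : set (R3 R) :=
  [set x | forall r, match s r with
                     | Some b => coord3 x r = endpoint T r b
                     | None => lo T r <= coord3 x r <= hi T r
                     end].

Definition cell (R : realType) (T : cuboid R) : set (R3 R) :=
  [set x | forall r, lo T r <= coord3 x r <= hi T r].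
Definition open_cell (R : realType) (T : cuboid R) : set (R3 R) :=
  [set x | forall r, lo T r < coord3 x r < hi T r].

Definition side_integral (R : realType) (T : cuboid R) (s : subent) (r : 'I_3)
    (f : R -> R) : R :=
  match s r with
  | Some b => f (endpoint T r b)
  | None => \int[@lebesgue_measure R]_(t in `[lo T r, hi T r]) f t
  end.

(* Integral of p over a vertex (the point value), edge, face or the cell. *)
Definition ent_integral (R : realType) (T : cuboid R) (s : subent)
    (p : poly3 R) : R :=
  side_integral T s axis_x (fun x =>
    side_integral T s axis_y (fun y =>
      side_integral T s axis_z (fun z => peval p (x, y, z)))).

Section ShapeFunctions.
Variable R : realType.
Variable k : nat.

Definition shape_deg (i j r : 'I_3) : int :=
  if i == j then k%:Z - 1
  else if r == i then k%:Z - 2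
  else if r == j then k%:Z
  else k%:Z - 1.

Definition Xi_space : set 'M[poly3 R]_3 :=
  [set tau | \tr tau = 0 /\ forall i j, Qspace (shape_deg i j) (tau i j)].

(* (der, i, j, s): the moments on s of tau_ij, or of its j-th partial
   derivative if der is true. *)
Definition dof_group := (bool * 'I_3 * 'I_3 * subent)%type.

(* m is the axis of the diagonal entry that carries no degrees of freedom. *)
Definition is_dof_group (m : 'I_3) (g : dof_group) : bool :=
  let: (der, i, j, s) := g in
  if i == j then (i != m) && ~~ der
  else [|| is_edge i s,
           is_face i j s && ~~ der,
           [exists l, [&& l != i, l != j & is_face i l s]]
         | is_cell s && ~~ der].

(* Degree bounds of the test space; the degree is 0 in the variables that are
   constant on s. *)
Definition test_deg (g : dof_group) (r : 'I_3) : int :=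
  let: (_, i, j, s) := g in
  if ~~ is_free s r then 0
  else if i == j then k%:Z - 3
  else if r == i then k%:Z - 2
  else if r == j then k%:Z - 4
  else k%:Z - 3.

Definition dof_value (T : cuboid R) (g : dof_group) (p : poly3 R)
    (tau : 'M[poly3 R]_3) : R :=
  let: (der, i, j, s) := g in
  ent_integral T s
    ((if der then mpoly.mderiv j (tau i j) else tau i j) * p).

(* B selects a basis of the test space of each group of moments.  At a vertex
   the degree of freedom is the value itself, i.e. the test function is 1. *)
Definition dof_basis (m : 'I_3) (B : dof_group -> seq (poly3 R)) :=
  forall g, is_dof_group m g -> is_basis (@Qspace R (test_deg g)) (B g).

Definition dofs (m : 'I_3) (B : dof_group -> seq (poly3 R)) (T : cuboid R)
  : seq ('M[poly3 R]_3 -> R) :=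
  flatten [seq [seq dof_value T g p
               | p <- if is_vertex g.2 then [:: 1] else B g]
          | g <- enum (is_dof_group m)].

End ShapeFunctions.

Definition leb3 (R : realType) :=
  (@lebesgue_measure R \x @lebesgue_measure R \x @lebesgue_measure R)%E.

Definition contractible (R : realType) (A : set (R3 R)) :=
  exists (x0 : R3 R) (H : R3 R * R -> R3 R),
    [/\ A x0,
        {within A `*` `[0, 1], continuous H},
        forall x t, A x -> 0 <= t <= 1 -> A (H (x, t)),
        forall x, A x -> H (x, 0) = x
      & forall x, A x -> H (x, 1) = x0].

(* Near each boundary point, A is the strict hypograph of a Lipschitz function
   in some orthonormal coordinate system. *)
Definition lipschitz_boundary (R : realType) (A : set (R3 R)) :=
  forall x, (closure A `\` A°) x ->
  exists (P : 'M[R]_3) (g : R * R -> R) (U : set (R3 R)),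
    let c y r := \sum_(t < 3) P r t * coord3 y t in
    [/\ P *m P^T = 1%:M,
        exists K : R, K.-lipschitz g,
        nbhs x U
      & forall y, U y ->
          (A y <-> c y axis_z < g (c y axis_x, c y axis_y))].

Definition contractible_lipschitz_domain (R : realType) (Omega : set (R3 R)) :=
  [/\ open Omega, connected Omega, contractible Omega
    & lipschitz_boundary Omega].

Definition cuboid_mesh (R : realType) (Omega : set (R3 R)) (n : nat)
    (Th : 'I_n -> cuboid R) :=
  [/\ closure Omega = \bigcup_a cell (Th a),
      forall a b, a != b -> open_cell (Th a) `&` open_cell (Th b) = set0
    & forall a b, cell (Th a) `&` cell (Th b) !=set0 ->
        exists s s', cell (Th a) `&` cell (Th b) = subent_set (Th a) s /\
                     cell (Th a) `&` cell (Th b) = subent_set (Th b) s'].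

(* v is the field on Omega, determined up to a null set; q a is the polynomial
   field on the cell Th a, from which the traces on its boundary are taken. *)
Definition fe_space (R : realType) (k : nat) (m : 'I_3) (n : nat)
    (Th : 'I_n -> cuboid R) : set (R3 R -> 'M[R]_3) :=
  [set v : R3 R -> 'M[R]_3 | exists q : 'I_n -> 'M[poly3 R]_3,
    [/\ forall a, Xi_space k (q a),
        forall a, {ae @leb3 R, forall x, cell (Th a) x ->
                     v x = map_mx (fun p => peval p x) (q a)}
      & forall a b der i j s s' p,
          is_dof_group m (der, i, j, s) -> is_dof_group m (der, i, j, s') ->
          ~~ is_cell s ->
          subent_set (Th a) s = subent_set (Th b) s' ->
          Qspace (test_deg k (der, i, j, s)) p ->
          dof_value (Th a) (der, i, j, s) p (q a) =
          dof_value (Th b) (der, i, j, s') p (q b)]].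

Definition unit_vec (R : realType) (r : 'I_3) : R3 R :=
  ((r == axis_x)%:R, (r == axis_y)%:R, (r == axis_z)%:R).

Definition partial (R : realType) (r : 'I_3) (f : R3 R -> R) : R3 R -> R :=
  fun x => 'D_(unit_vec R r) f x.

Definition smooth (R : realType) (f : R3 R -> R) :=
  forall rs : seq 'I_3, let g := foldr (@partial R) f rs in
    continuous g /\ forall r x, derivable g x (unit_vec R r).

Definition test_function (R : realType) (Omega : set (R3 R))
    (phi : R3 R -> R) :=
  smooth phi /\
  exists2 K, compact K /\ K `<=` Omega & forall x, ~ K x -> phi x = 0.

(* f is a Borel representative of an element of L^2(Omega). *)
Definition L2 (R : realType) (Omega : set (R3 R)) (f : R3 R -> R) : Prop :=
  f \_ Omega \in Lfun (@leb3 R) 2%:E.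

Definition weak_divergence (R : realType) (Omega : set (R3 R))
    (w : R3 R -> 'M[R]_3) (g : R3 R -> 'cV[R]_3) :=
  forall phi, test_function Omega phi -> forall i,
    \int[@leb3 R]_(x in Omega) (\sum_j w x i j * partial j phi x) =
    - \int[@leb3 R]_(x in Omega) (g x i 0 * phi x).

(* H(div, Omega; T); w is a Borel representative of the class of v. *)
Definition Hdiv_traceless (R : realType) (Omega : set (R3 R))
  : set (R3 R -> 'M[R]_3) :=
  [set v | exists (w : R3 R -> 'M[R]_3) (g : R3 R -> 'cV[R]_3),
    [/\ {ae @leb3 R, forall x, Omega x -> v x = w x},
        forall x, Omega x -> \tr (w x) = 0,
        forall i j, L2 Omega (fun x => w x i j),
        forall i, L2 Omega (fun x => g x i 0)
      & weak_divergence Omega w g]].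

(* Main.v *)
(* Unisolvence: every degree of freedom tested against a monomial is a tensor
   product of three univariate functionals, so injectivity reduces to three
   interpolation problems on an interval: moments only, end values and moments,
   Hermite end data and moments.  A kernel element q of the latter two factors
   as q = w h with w of constant sign, and testing q against h gives h = 0.
   The admissible groups of moments for an entry are those satisfying one
   condition per axis, so their total number factors over the axes and equals
   the dimension of the shape functions.

   Conformity: on a common face normal to x_j the same argument in the two
   remaining variables shows that the entries (i, j) agree from both sides.
   With half-open cells every point of Omega lies in exactly one cell.  By
   Fubini it suffices to integrate by parts on each line parallel to x_j, where
   the jumps at the ends of the cells cancel in pairs. *)

Require Import Defs.
From mathcomp Require Import all_boot all_order all_algebra.
From mathcomp Require Import all_classical all_reals all_analysis.
From mathcomp Require mpoly.
From mathcomp Require Import measurable_realfun.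
From mathcomp Require Import zify ring lra.
From HB Require Import structures.

Set Implicit Arguments.
Unset Strict Implicit.
Unset Printing Implicit Defensive.

Import Order.TTheory GRing.Theory Num.Theory.
Import numFieldNormedType.Exports.

Local Open Scope classical_set_scope.
Local Open Scope ring_scope.

(** * Tensor products of functionals *)

(** The entry (m, m) has no degrees of freedom of its own: on a face normal to [x_m] its trace is
    minus the sum of the other two diagonal entries. These must therefore be continuous across a
    face that is not normal to their own axis, which is why diagonal entries are controlled on all
    27 subentities. An off-diagonal entry (i, j) matters only on faces normal to [x_j]; along [x_i]
    it is seen through moments over the full side alone.

    The obstacle to a pure product argument is the derivative flag, a single bit shared by the three
    axes. It is tamed by letting it act along [x_j] only: there it adds the two end slopes that
    complete the Hermite data, and on the other axes it is forced to be false.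

    The bases of the test spaces are arbitrary, so they enter only through their span and their
    size; all computations use monomials.

    In the conformity part the cancellation of jumps is arranged to hold on every line, including
    lines that run inside faces or edges of the mesh. There the orientation of the half-open cells
    decides which cells are crossed. *)

Section Tensor.
Variable R : realType.
Implicit Types (p q : poly3 R) (lam : 'I_3 -> nat -> R) (mu : mpoly.multinom 3).

(* The tensor product of the functionals on polynomials in x_r that take the
   value lam r n at x_r ^ n. *)
Definition tensor lam p : R :=
  \sum_(mu <- mpoly.msupp p) mpoly.mcoeff mu p * \prod_r lam r (mu r).

(** The support varies with the polynomial; a common list of multi-indices makes linearity a
    termwise computation. *)
Lemma tensorE s lam p : uniq s -> {subset mpoly.msupp p <= s} ->
  tensor lam p = \sum_(mu <- s) mpoly.mcoeff mu p * \prod_r lam r (mu r).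
Proof.
move=> us ps; rewrite (bigID (mem (mpoly.msupp p))) /= [X in _ + X]big1 ?addr0.
  rewrite -big_filter; apply: perm_big; apply: uniq_perm.
  - exact: mpoly.msupp_uniq.
  - by rewrite filter_uniq.
  - move=> mu; rewrite mem_filter andb_idr //; exact: ps.
by move=> mu /mpoly.memN_msupp_eq0 ->; rewrite mul0r.
Qed.

Lemma tensor_is_linear lam : linear_for *%R (tensor lam).
Proof.
move=> c p q; pose s := undup (mpoly.msupp p ++ mpoly.msupp q).
have us : uniq s by rewrite undup_uniq.
rewrite (tensorE (s := s) lam us); last first.
  move=> mu /mpoly.msuppD_le; rewrite mem_cat mem_undup mem_cat.
  by case/orP => [/mpoly.msuppZ_le ->|->]; rewrite ?orbT.
rewrite !(tensorE (s := s) lam us).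
- rewrite mulr_sumr -big_split /=; apply: eq_bigr => mu _.
  by rewrite mpoly.mcoeffD mpoly.mcoeffZ mulrDl mulrA.
- by move=> mu h; rewrite mem_undup mem_cat h orbT.
- by move=> mu h; rewrite mem_undup mem_cat h.
Qed.

HB.instance Definition _ lam :=
  GRing.isLinear.Build R (poly3 R) R *%R (tensor lam) (tensor_is_linear lam).

Lemma tensorX lam mu :
  tensor lam (mpoly.mpolyX R mu) = \prod_r lam r (mu r).
Proof.
by rewrite /tensor mpoly.msuppX big_seq1 mpoly.mcoeffX eqxx mul1r.
Qed.

Lemma tensorMX lam p mu : tensor lam (p * mpoly.mpolyX R mu) =
  tensor (fun r n => lam r (n + mu r)%N) p.
Proof.
elim/mpoly.mpolyind: p => [|c nu p _ _ IH]; first by rewrite mul0r !linear0.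
rewrite mulrDl -scalerAl -mpoly.mpolyXD !linearP /= IH !tensorX.
by congr (_ * _ + _); apply: eq_bigr => r _; rewrite mpoly.mnmDE.
Qed.

(** At [n = 0] the truncated predecessor is harmless because of the factor [n%:R]. *)
Lemma tensor_mderiv lam j p : tensor lam (mpoly.mderiv j p) =
  tensor (fun r n => if r == j then n%:R * lam r n.-1 else lam r n) p.
Proof.
elim/mpoly.mpolyind: p => [|c nu p _ _ IH]; first by rewrite !linear0.
rewrite linearP /= mpoly.mderivX !linearP /= {}IH !tensorX linearZ /= tensorX.
congr (_ * _ + _); rewrite (bigD1 j) //= [RHS](bigD1 j) //= eqxx mulrA.
rewrite mpoly.mnmBE mpoly.mnm1E eqxx subn1; congr (_ * _).
apply: eq_bigr => r rj; rewrite mpoly.mnmBE mpoly.mnm1E (negPf rj).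
by rewrite eq_sym (negPf rj) subn0.
Qed.

Lemma mevalE_tensor (v : 'I_3 -> R) p :
  mpoly.meval v p = tensor (fun r n => v r ^+ n) p.
Proof. exact: mpoly.mevalE. Qed.

(** Coefficients are tensor functionals too, so a polynomial killed by all tensor functionals is
    zero. *)
Lemma mcoeffE_tensor mu p :
  mpoly.mcoeff mu p = tensor (fun r n => (n == mu r)%:R) p.
Proof.
elim/mpoly.mpolyind: p => [|c nu p _ _ IH]; first by rewrite !linear0.
rewrite !linearP /= {}IH tensorX mpoly.mcoeffX; congr (_ * _ + _).
have [->|nmu] := eqVneq nu mu; first by rewrite big1 // => r _; rewrite eqxx.
apply/esym/eqP; rewrite prodf_seq_eq0; apply/hasP.
have [r rP] : exists r, nu r != mu r.
  apply: contrapT => h; move/eqP: nmu; apply; apply/mpoly.mnmP => r.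
  by apply/eqP; apply: contrapT => /negP hr; apply: h; exists r.
by exists r; rewrite ?mem_index_enum //= (negPf rP).
Qed.

Lemma eq_tensor lam lam' p : (forall r n, lam r n = lam' r n) ->
  tensor lam p = tensor lam' p.
Proof.
by move=> e; apply: eq_bigr => mu _; congr (_ * _); apply: eq_bigr => r _.
Qed.

Definition with_axis (T : Type) (r : 'I_3) (nu : T) (lam : 'I_3 -> T) :
  'I_3 -> T := fun r' => if r' == r then nu else lam r'.

(* The functionals in L, given by their values on the monomials, separate the
   univariate polynomials of degree at most d. *)
Definition separating (d : nat) (L : set (nat -> R)) :=
  forall q : {poly R}, (size q <= d.+1)%N ->
    (forall l, L l -> \sum_(n < d.+1) q`_n * l n = 0) -> q = 0.

(** Contracting [p] with [lam] along the other axes leaves a univariate polynomial in [x_r], with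
    coefficients [c n], and [L] separates it. The arbitrary [nu] in the conclusion lets the axes be
    treated one after the other. *)
Lemma tensor_separating d L lam r p :
  (forall mu, mu \in mpoly.msupp p -> (mu r <= d)%N) -> separating d L ->
  (forall l, L l -> tensor (with_axis r l lam) p = 0) ->
  forall nu, tensor (with_axis r nu lam) p = 0.
Proof.
move=> pd sL h nu.
pose c n := \sum_(mu <- mpoly.msupp p | mu r == n)
  mpoly.mcoeff mu p * \prod_(r' | r' != r) lam r' (mu r').
have E l : tensor (with_axis r l lam) p = \sum_(n < d.+1) c n * l n.
  rewrite /tensor big_seq_cond.
  rewrite (partition_big (fun mu : mpoly.multinom 3 => inord (mu r) : 'I_d.+1)
     predT) //=.
  apply: eq_bigr => n _; rewrite /c mulr_suml [RHS]big_seq_cond.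
  apply: eq_big => mu.
    rewrite andbT; case: (boolP (mu \in _)) => //= /pd mud.
    by apply/eqP/eqP => [<-|e]; rewrite ?inordK //; apply/val_inj; rewrite /= inordK.
  rewrite andbT => /andP[/pd mud /eqP <-].
  rewrite (bigD1 r) //= /with_axis eqxx inordK // -!mulrA; congr (_ * _).
  rewrite mulrC; congr (_ * _); apply: eq_bigr => r' /negPf -> //.
rewrite E; have /polyP q0 : \poly_(n < d.+1) c n = 0.
  apply: sL => [|l Ll]; first exact: size_poly.
  by rewrite -[RHS](h _ Ll) E; apply: eq_bigr => n _; rewrite coef_poly ltn_ord.
apply: big1 => n _; have := q0 n.
by rewrite coef_poly ltn_ord coef0 => ->; rewrite mul0r.
Qed.

End Tensor.

(** * Polynomial interpolation on an interval *)

Section PolyIntegral.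
Variable R : realType.
Implicit Types (a b : R) (p q h w : {poly R}).

(** The constant coefficient is a division by zero, hence 0. *)
Definition prim q : {poly R} := \poly_(i < (size q).+1) (q`_i.-1 / i%:R).

Lemma coef_prim q i : (prim q)`_i = q`_i.-1 / i%:R.
Proof.
rewrite coef_poly; case: ltnP => // h.
by rewrite nth_default ?mul0r //; case: i h.
Qed.

Lemma deriv_prim q : (prim q)^`() = q.
Proof.
apply/polyP => i; rewrite coef_deriv coef_prim /= -mulrnAr -(mulr_natr _^-1).
by rewrite mulVf ?mulr1 // pnatr_eq0.
Qed.

Definition pint a b q : R := (prim q).[b] - (prim q).[a].

Lemma pint_is_linear a b : linear_for *%R (pint a b).
Proof.
move=> c p q; have e : prim (c *: p + q) = c *: prim p + prim q.
  by apply/polyP => i; rewrite !(coef_prim, coefE) mulrDl mulrA.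
by rewrite /pint e !hornerD !hornerZ /=; ring.
Qed.

HB.instance Definition _ a b :=
  GRing.isLinear.Build R {poly R} R *%R (pint a b) (pint_is_linear a b).

Lemma Rintegral_horner a b q : a < b ->
  \int[@lebesgue_measure R]_(t in `[a, b]) q.[t] = pint a b q.
Proof.
move=> ab; rewrite /Rintegral (continuous_FTC2 (F := horner (prim q)) ab) //.
- exact/continuous_subspaceT/continuous_horner.
- split; first by move=> t _; exact: derivable_horner.
  + by apply: cvg_at_right_filter; exact: continuous_horner.
  + by apply: cvg_at_left_filter; exact: continuous_horner.
- by move=> t _; rewrite -derivE deriv_prim.
Qed.

Lemma poly_itv_eq0 a b p : a < b -> {in `[a, b], forall t, p.[t] = 0} -> p = 0.
Proof.
move=> ab h; apply/eqP; apply: contrapT => /negP p0.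
(* Infinitely many distinct points of the interval; [size p] of them exceed the number of roots of a
   nonzero [p]. *)
pose t i : R := a + (b - a) / i.+1%:R.
have tab i : t i \in `[a, b].
  rewrite in_itv /= /t lerDl divr_ge0 ?subr_ge0 ?(ltW ab) //=.
  rewrite -lerBrDl ler_pdivrMr ?ltr0n // ler_peMr ?ler1n //.
  by rewrite subr_ge0 ltW.
have := @max_poly_roots _ p [seq t i | i <- iota 0 (size p)] p0.
rewrite size_map size_iota ltnn => /(_ _ _)/wrap[]//.
- by apply/allP => _ /mapP[i _ ->]; apply/eqP/h.
- rewrite map_inj_uniq ?iota_uniq // => i j /addrI /mulfI.
  by rewrite subr_eq0 gt_eqF // => /(_ isT) /invr_inj /eqP; rewrite eqr_nat => /eqP [].
Qed.

(** The primitive is monotone with equal end values, hence constant on the interval and then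
    constant as a polynomial, so its derivative vanishes. *)
Lemma pint_eq0 a b q : a < b -> {in `[a, b], forall t, 0 <= q.[t]} ->
  pint a b q = 0 -> q = 0.
Proof.
move=> ab q0 /eqP; rewrite subr_eq0 => /eqP e.
have mono := @ger0_derive1_le_cc R (horner (prim q)) a b.
suff : prim q - ((prim q).[a])%:P = 0.
  move/(congr1 (@deriv R)); rewrite derivB derivC deriv_prim subr0.
  by rewrite deriv0.
apply: (poly_itv_eq0 ab) => t tab; have := tab; rewrite in_itv /= => /andP[ta tb].
have {}mono : {in `[a, b] &, {homo horner (prim q) : x y / x <= y}}.
  apply: mono => // [x xab|].
    by rewrite -derivE deriv_prim; apply: q0; exact: subset_itv_oo_cc.
  exact/continuous_subspaceT/continuous_horner.
rewrite !hornerE; apply/eqP; rewrite subr_eq0 eq_le -{1}e !mono //.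
all: by rewrite in_itv /= lexx ltW.
Qed.

(* Testing w h against h itself gives a vanishing integral of the
   semidefinite polynomial w h^2. *)
Lemma pint_weight_eq0 a b (e : R) w h d : a < b -> e != 0 -> w != 0 ->
  {in `[a, b], forall t, 0 <= e * w.[t]} ->
  (size h <= d)%N -> (forall i, (i < d)%N -> pint a b (w * h * 'X^i) = 0) ->
  h = 0.
Proof.
move=> ab e0 w0 ew sh orth; apply/eqP; apply: contrapT => /negP h0.
suff : e *: (w * h * h) == 0.
  by rewrite scaler_eq0 !mulf_eq0 (negPf e0) (negPf w0) (negPf h0).
apply/eqP; apply: (pint_eq0 ab) => [t tab|].
  rewrite hornerZ !hornerM; have := ew _ tab; have := sqr_ge0 h.[t].
  by move=> *; rewrite !mulrA -mulrA -expr2 mulr_ge0.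
rewrite linearZ /= -[X in w * h * X]coefK poly_def mulr_sumr linear_sum /=.
rewrite big1 ?mulr0 // => i _.
by rewrite -scalerAr linearZ /= orth ?mulr0 // (leq_trans _ sh).
Qed.

Lemma factor_roots2 a b q : a < b -> q.[a] = 0 -> q.[b] = 0 ->
  exists2 h, q = ('X - a%:P) * ('X - b%:P) * h & (size h <= size q - 2)%N.
Proof.
move=> ab /eqP/factor_theorem[q1 ->]; rewrite hornerM hornerXsubC => /eqP.
rewrite mulf_eq0 subr_eq0 (gt_eqF ab) orbF => /factor_theorem[h ->].
exists h; first by ring.
have [->|h0] := eqVneq h 0; first by rewrite size_poly0.
rewrite !size_Mmonic ?monicXsubC ?mulf_neq0 ?polyXsubC_eq0 ?size_XsubC //.
by rewrite !addn2 subn2.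
Qed.

Lemma XsubC2_neq0 a b : ('X - a%:P) * ('X - b%:P) != 0 :> {poly R}.
Proof. by rewrite mulf_neq0 // polyXsubC_eq0. Qed.

Lemma XsubC2_le0 a b t : t \in `[a, b] ->
  0 <= -1 * (('X - a%:P) * ('X - b%:P)).[t].
Proof.
rewrite in_itv /= => /andP[*]; rewrite hornerM !hornerXsubC mulN1r -mulrN.
by rewrite mulr_ge0 ?subr_ge0 // opprB subr_ge0.
Qed.

Lemma interpolation_moments a b d q : a < b -> (size q <= d)%N ->
  (forall i, (i < d)%N -> pint a b (q * 'X^i) = 0) -> q = 0.
Proof.
move=> ab sq orth; apply: (@pint_weight_eq0 a b 1 1 q d) => //.
- exact: oner_neq0.
- by move=> t _; rewrite !hornerE /=.
- by move=> i id; rewrite mul1r orth.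
Qed.

Lemma interpolation_endpoints a b d q : a < b -> (size q <= d.+2)%N ->
  q.[a] = 0 -> q.[b] = 0 ->
  (forall i, (i < d)%N -> pint a b (q * 'X^i) = 0) -> q = 0.
Proof.
move=> ab sq qa qb orth; have [h qh sh] := factor_roots2 ab qa qb.
(* The weight is nonpositive between its two roots, hence the sign -1. *)
rewrite qh (@pint_weight_eq0 a b (-1) (('X - a%:P) * ('X - b%:P)) h d) ?mulr0 //.
- exact: XsubC2_neq0.
- exact: XsubC2_le0.
- by rewrite (leq_trans sh) // leq_subLR add2n.
- by move=> i id; rewrite -qh orth.
Qed.

(** Both ends are double roots: after division by the simple factors, the derivative of [q] at an
    end is the cofactor there times plus or minus [b - a], so the cofactor vanishes again. The
    remaining weight is a square. *)
Lemma interpolation_hermite a b d q : a < b -> (size q <= d.+4)%N ->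
  q.[a] = 0 -> q.[b] = 0 -> q^`().[a] = 0 -> q^`().[b] = 0 ->
  (forall i, (i < d)%N -> pint a b (q * 'X^i) = 0) -> q = 0.
Proof.
move=> ab sq qa qb q'a q'b orth.
have [h qh sh] := factor_roots2 ab qa qb.
have ba0 : b - a != 0 by rewrite subr_eq0 gt_eqF.
have q'E t : q^`().[t] =
    ((t - b) + (t - a)) * h.[t] + (t - a) * (t - b) * h^`().[t].
  rewrite qh !(derivM, derivB, derivX, derivC).
  by rewrite !(hornerD, hornerM, hornerXsubC, hornerN, hornerC, hornerX); ring.
have ha : h.[a] = 0.
  move/eqP: q'a; rewrite q'E subrr addr0 !mul0r addr0 -opprB mulNr oppr_eq0.
  by rewrite mulf_eq0 (negPf ba0) => /eqP.
have hb : h.[b] = 0.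
  move/eqP: q'b; rewrite q'E subrr add0r mulr0 mul0r addr0.
  by rewrite mulf_eq0 (negPf ba0) => /eqP.
have [g hg sg] := factor_roots2 ab ha hb.
have qg : q = (('X - a%:P) * ('X - b%:P)) ^+ 2 * g by rewrite qh hg; ring.
rewrite qg (@pint_weight_eq0 a b 1 ((('X - a%:P) * ('X - b%:P)) ^+ 2) g d)
  ?mulr0 //.
- by rewrite expf_neq0 // XsubC2_neq0.
- by move=> t _; rewrite mul1r horner_exp sqr_ge0.
- by rewrite (leq_trans sg) // leq_subLR add2n (leq_trans sh) // leq_subLR.
- by move=> i id; rewrite -qg orth.
Qed.

End PolyIntegral.

(** * Degrees of freedom along an axis *)

Section AxisFunctionals.
Variable R : realType.
Implicit Types (T : cuboid R) (s : subent) (o : option bool) (r i j : 'I_3).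
Implicit Types (q : {poly R}) (p : poly3 R).

Definition side T o r q : R :=
  if o is Some b then q.[endpoint T r b] else pint (lo T r) (hi T r) q.

Lemma side_is_linear T o r : linear_for *%R (side T o r).
Proof.
move=> c p q; rewrite /side; case: o => [b|]; last by rewrite linearP.
by rewrite hornerD hornerZ.
Qed.

HB.instance Definition _ T o r :=
  GRing.isLinear.Build R {poly R} R *%R (side T o r) (side_is_linear T o r).

Lemma side_integral_horner T s r q :
  side_integral T s r (fun t => q.[t]) = side T (s r) r q.
Proof.
rewrite /side_integral /side; case: (s r) => // .
by rewrite Rintegral_horner // lo_lt_hi.
Qed.

(** Stated for an arbitrary indexed family because the inner integrals of [ent_integral] leave sums
    over the support of [p] whose coefficients depend on the outer variables. *)
Lemma side_integral_sum (J : Type) (l : seq J) (c : J -> R) (e : J -> nat) T s r :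
  side_integral T s r (fun t => \sum_(x <- l) c x * t ^+ e x) =
  \sum_(x <- l) c x * side T (s r) r 'X^(e x).
Proof.
pose q : {poly R} := \sum_(x <- l) c x *: 'X^(e x).
have -> : (fun t => \sum_(x <- l) c x * t ^+ e x) = (fun t => q.[t]).
  by apply/funext => t; rewrite horner_sum; apply: eq_bigr => x _;
    rewrite hornerZ hornerXn.
rewrite side_integral_horner linear_sum /=.
by apply: eq_bigr => x _; rewrite linearZ.
Qed.

Lemma forall_axis (P : 'I_3 -> Prop) :
  (forall r, P r) <-> [/\ P axis_x, P axis_y & P axis_z].
Proof.
split=> [h|[hx hy hz] [[|[|[|]]] lt3]] //.
- by rewrite (_ : Ordinal _ = axis_x) //; apply/val_inj.
- by rewrite (_ : Ordinal _ = axis_y) //; apply/val_inj.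
- by rewrite (_ : Ordinal _ = axis_z) //; apply/val_inj.
Qed.

Lemma prod_axis (S : comPzRingType) (F : 'I_3 -> S) :
  \prod_r F r = F axis_x * F axis_y * F axis_z.
Proof.
rewrite !big_ord_recl big_ord0 mulr1 mulrA.
by congr (F _ * F _ * F _); apply/val_inj.
Qed.

(** Iterated integrals of monomials factor over the axes. From here on unisolvence is pure algebra,
    without Lebesgue integrals. *)
Lemma ent_integralE T s p :
  ent_integral T s p = tensor (fun r n => side T (s r) r 'X^n) p.
Proof.
rewrite /ent_integral.
pose c mu := mpoly.mcoeff mu p; pose S := side T.
pose E r (mu : mpoly.multinom 3) := side T (s r) r 'X^(mu r).
have eqz x y : side_integral T s axis_z (fun z => peval p (x, y, z)) =
    \sum_(mu <- mpoly.msupp p)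
      (c mu * E axis_z mu * x ^+ mu axis_x) * y ^+ mu axis_y.
  have -> : (fun z => peval p (x, y, z)) = fun z => \sum_(mu <- mpoly.msupp p)
      (c mu * x ^+ mu axis_x * y ^+ mu axis_y) * z ^+ mu axis_z.
    apply/funext => z; rewrite /peval mpoly.mevalE; apply: eq_bigr => mu _.
    by rewrite prod_axis !mulrA.
  by rewrite side_integral_sum; apply: eq_bigr => mu _; rewrite -/(E axis_z mu); ring.
under [X in side_integral _ _ _ X]eq_fun.
  move=> x; under [X in side_integral _ _ _ X]eq_fun do rewrite eqz.
  rewrite side_integral_sum.
  under eq_bigr => mu _ do rewrite mulrAC.
  over.
rewrite side_integral_sum; apply: eq_bigr => mu _.
by rewrite prod_axis -!mulrA; congr (_ * _); rewrite /E; ring.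
Qed.

(* The factor along the axis r of a moment against a monomial of degree b in x_r. *)
Definition axis_dof T r o (der : bool) (b : nat) : nat -> R := fun n =>
  if der then n%:R * side T o r 'X^(n.-1 + b) else side T o r 'X^(n + b).

Lemma dof_valueX T der i j s (beta : mpoly.multinom 3) (tau : 'M[poly3 R]_3) :
  dof_value T (der, i, j, s) (mpoly.mpolyX R beta) tau =
  tensor (fun r => axis_dof T r (s r) (der && (r == j)) (beta r)) (tau i j).
Proof.
rewrite /dof_value ent_integralE tensorMX; case: der => /=.
  by rewrite tensor_mderiv; apply: eq_tensor => r n; rewrite /axis_dof; case: eqP.
exact: eq_tensor.
Qed.

Lemma axis_dof_poly T r o der b q N : (size q <= N)%N ->
  \sum_(n < N) q`_n * axis_dof T r o der b n =
  side T o r ((if der then q^`() else q) * 'X^b).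
Proof.
move=> sq; have qE : q = \poly_(n < N) q`_n.
  apply/polyP => n; rewrite coef_poly; case: ltnP => // Nn.
  by rewrite nth_default // (leq_trans sq).
rewrite [in RHS]qE poly_def; case: der => /=.
  rewrite raddf_sum mulr_suml linear_sum /=; apply: eq_bigr => n _.
  rewrite derivZ derivXn -scalerAl linearZ /= /axis_dof exprD.
  by rewrite mulr_natl -raddfMn -mulrnAl.
rewrite mulr_suml linear_sum /=; apply: eq_bigr => n _.
by rewrite -scalerAl linearZ /= /axis_dof exprD.
Qed.

Variable k : nat.

(** Off the diagonal, the subentities spanning [x_i] are exactly the edges [e_i], the faces [F_ij]
    and [F_il] and the cell, and a derivative occurs on those that sit at an end along [x_j]. The
    flag [der] is that of the axis [r] alone. *)
Definition axis_ok i j r o (der : bool) : bool :=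
  if i == j then ~~ der
  else if r == i then (o == None) && ~~ der
  else if r == j then der ==> (o != None)
  else ~~ der.

Definition axis_test_deg i j r o : int :=
  if o is Some _ then 0
  else if i == j then k%:Z - 3
  else if r == i then k%:Z - 2
  else if r == j then k%:Z - 4
  else k%:Z - 3.

Lemma test_degE der i j s r :
  test_deg k (der, i, j, s) r = axis_test_deg i j r (s r).
Proof. by rewrite /test_deg /axis_test_deg /is_free; case: (s r). Qed.

(** The admissible positions [O] are a parameter because the continuity argument on a face may use
    only one end of the normal axis. *)
Definition axis_dofs T i j r (O : set (option bool)) : set (nat -> R) :=
  [set l | exists o der b, [/\ O o, axis_ok i j r o der,
     Posz b <= axis_test_deg i j r o & l = axis_dof T r o der b]].

Definition axis_deg i j r : nat :=
  if i == j then k.-1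
  else if r == i then k.-2
  else if r == j then k
  else k.-1.

Hypothesis k3 : (3 <= k)%N.

Lemma shape_degE i j r : shape_deg k i j r = axis_deg i j r.
Proof. by rewrite /shape_deg /axis_deg; case: ifP => _; try case: ifP => _; try case: ifP => _; lia. Qed.

(** Conditions match coefficients on each axis: 2 + (k-2) = k on the diagonal; off it, k-1 moments
    along [x_i], 4 + (k-3) = k+1 Hermite data along [x_j], and 2 + (k-2) = k along [x_l]. *)
Lemma separating_axis_dofs T i j r :
  separating (axis_deg i j r) (axis_dofs T i j r setT).
Proof.
move=> q sq h; have ab := lo_lt_hi T r.
have {}h o der b : axis_ok i j r o der -> Posz b <= axis_test_deg i j r o ->
    side T o r ((if der then q^`() else q) * 'X^b) = 0.
  by move=> ok bd; rewrite -(axis_dof_poly _ _ _ _ _ sq); apply: h; exists o, der, b.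
have endp bb der : axis_ok i j r (Some bb) der ->
    (if der then q^`() else q).[endpoint T r bb] = 0.
  by move=> ok; have := h (Some bb) der 0%N ok isT; rewrite /= expr0 mulr1.
have mom b : axis_ok i j r None false -> Posz b <= axis_test_deg i j r None ->
    pint (lo T r) (hi T r) (q * 'X^b) = 0 by move=> ok bd; apply: (h None false).
move: sq endp mom; rewrite /axis_deg /axis_ok /axis_test_deg.
(* Shared by the diagonal entries and by the axis [x_l] of the off-diagonal ones. *)
have simple (K : nat) : (2 <= K)%N -> (size q <= K.-1.+1)%N ->
    q.[lo T r] = 0 -> q.[hi T r] = 0 ->
    (forall b, Posz b <= K%:Z - 3 -> pint (lo T r) (hi T r) (q * 'X^b) = 0) ->
    q = 0.
  move=> K2 sq qa qb orth.
  apply: (@interpolation_endpoints _ _ _ (K - 2) q ab) => //.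
    by apply: (leq_trans sq); lia.
  by move=> b bK; apply: orth; lia.
case: (i == j) => [sq endp mom|].
  apply: (simple k) => //; first by lia.
  - exact: (endp false false).
  - exact: (endp true false).
  - by move=> b bk; apply: mom.
case: (r == i) => [sq endp mom|].
  apply: (@interpolation_moments _ _ _ k.-1 q ab); first by apply: (leq_trans sq); lia.
  by move=> b bk; apply: mom => //; lia.
case: (r == j) => [sq endp mom|sq endp mom].
  (* For [k = 3] there are no moments, and the four end conditions alone determine the cubic. *)
  apply: (@interpolation_hermite _ _ _ (k - 3) q ab); first by apply: (leq_trans sq); lia.
  - exact: (endp false false).
  - exact: (endp true false).
  - exact: (endp false true).
  - exact: (endp true true).
  - by move=> b bk; apply: mom => //; lia.
apply: (simple k) => //; first by lia.
- exact: (endp false false).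
- exact: (endp true false).
- by move=> b bk; apply: mom.
Qed.

End AxisFunctionals.

(** * Injectivity of the degrees of freedom on a cell *)

Section Injectivity.
Variable R : realType.
Implicit Types (T : cuboid R) (s : subent) (o : option bool) (r i j : 'I_3).
Implicit Types (p : poly3 R) (tau : 'M[poly3 R]_3).

(** The axes in [rs] are freed one at a time, while the others stay restricted to [S]. On a cell
    [rs] contains all axes, on a face all but the normal one. *)
Lemma tensor_separating_axes (d : 'I_3 -> nat) (S : 'I_3 -> set (nat -> R)) p
    (rs : seq 'I_3) :
  Qspace (fun r => d r) p ->
  (forall r, r \in rs -> separating (d r) (S r)) ->
  (forall lam, (forall r, S r (lam r)) -> tensor lam p = 0) ->
  forall lam, (forall r, r \notin rs -> S r (lam r)) -> tensor lam p = 0.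
Proof.
move=> pd + h; elim: rs => [|r rs IH] sep lam Slam.
  by apply: h => r; apply: Slam.
have -> : lam = with_axis r (lam r) lam.
  by apply/funext => r'; rewrite /with_axis; case: eqP => // ->.
apply: (@tensor_separating _ (d r) (S r)).
- by move=> mu /pd /(_ r).
- by apply: sep; rewrite mem_head.
- move=> l Sl; apply: IH => [r' r'rs|r' r'rs].
    by apply: sep; rewrite in_cons r'rs orbT.
  rewrite /with_axis; case: eqP => [-> //|/eqP r'r].
  by apply: Slam; rewrite in_cons negb_or r'r.
Qed.

Variable k : nat.

(** Choosing a functional on each axis yields three derivative flags, whereas a degree of freedom
    has one. Admissibility makes the flag false off [x_j], so the one chosen along [x_j] serves for
    the group. *)
Lemma axis_dofs_tensor T i j O p lam :
  (forall der s beta, (forall r, O r (s r)) -> (forall r, axis_ok i j r (s r) (der && (r == j))) ->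
     (forall r, Posz (beta r) <= axis_test_deg k i j r (s r)) ->
     (forall r, lam r = axis_dof T r (s r) (der && (r == j)) (beta r)) ->
     tensor lam p = 0) ->
  (forall r, axis_dofs k T i j r (O r) (lam r)) -> tensor lam p = 0.
Proof.
move=> h /choice[ob] /choice[der] /choice[b hb].
have derj r : der r = der j && (r == j).
  have [->|rj] := eqVneq r j; first by rewrite andbT.
  rewrite andbF; have [_ + _ _] := hb r; rewrite /axis_ok (negPf rj).
  by case: (i == j) => [/negPf//|]; case: (r == i) => [/andP[_ /negPf]|/negPf].
apply: (h (der j) [ffun r => ob r] b) => r; rewrite ffunE -?derj.
all: by case: (hb r).
Qed.

Lemma forall_ord3 (P : pred 'I_3) :
  [forall r, P r] = [&& P axis_x, P axis_y & P axis_z].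
Proof.
apply/forallP/and3P => [h|]; first by split; apply: h.
by move=> [? ? ?]; apply/forall_axis.
Qed.

Lemma exists_ord3 (P : pred 'I_3) :
  [exists r, P r] = [|| P axis_x, P axis_y | P axis_z].
Proof.
by rewrite -[LHS]negbK negb_exists forall_ord3 !negb_and !negbK.
Qed.

(** The list of edges, faces and cell becomes a conjunction over the axes, as required both for
    choosing axis by axis and for counting by distributivity. The proof is exhaustive. *)
Lemma is_dof_groupE (m : 'I_3) der i j s : is_dof_group m (der, i, j, s) =
  ((i != j) || (i != m)) &&
  [forall r, axis_ok i j r (s r) (der && (r == j))].
Proof.
rewrite forall_ord3 /is_dof_group /is_edge /is_face /is_cell /axis_ok.
have [<- {j}|ij] := eqVneq i j; rewrite ?eqxx ?(negPf ij) /=.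
  case: (i != m) => //=; case: der; rewrite ?andbF //=.
  by move: i => [[|[|[|]]] //= ?].
rewrite exists_ord3 !forall_ord3 /is_free.
case: (s axis_x) => [bx|]; case: (s axis_y) => [b_y|];
  case: (s axis_z) => [bz|]; case: der.
all: by move: i j ij => [[|[|[|]]] //= ?] [[|[|[|]]] //= ?].
Qed.

Definition in_dof_group m der i j s (beta : mpoly.multinom 3) :=
  is_dof_group m (der, i, j, s) /\
  forall r, Posz (beta r) <= test_deg k (der, i, j, s) r.

Lemma axis_dofs_dof_value T (m i j : 'I_3) O tau lam :
  (i != j) || (i != m) ->
  (forall der s beta, (forall r, O r (s r)) -> in_dof_group m der i j s beta ->
     (forall r, lam r = axis_dof T r (s r) (der && (r == j)) (beta r)) ->
     dof_value T (der, i, j, s) (mpoly.mpolyX R beta) tau = 0) ->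
  (forall r, axis_dofs k T i j r (O r) (lam r)) -> tensor lam (tau i j) = 0.
Proof.
move=> ijm h; apply: (@axis_dofs_tensor T i j O) => der s beta sO ok bd lamE.
have -> : lam = fun r => axis_dof T r (s r) (der && (r == j)) (beta r).
  exact/funext.
pose beta' := mpoly.Multinom [tuple beta r | r < 3].
have b'E r : beta' r = beta r by rewrite mpoly.multinomE tnth_mktuple.
rewrite -(h der s beta' sO).
- by rewrite dof_valueX; apply: eq_tensor => r n; rewrite b'E.
- split=> [|r]; last by rewrite test_degE b'E.
  by rewrite is_dof_groupE ijm; apply/forallP.
- by move=> r; rewrite b'E.
Qed.

Hypothesis k3 : (3 <= k)%N.

Lemma Qspace_shape i j p : Qspace (shape_deg k i j) p ->
  Qspace (fun r => axis_deg k i j r) p.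
Proof. by move=> pd mu /pd h r; have := h r; rewrite (shape_degE k3). Qed.

Lemma dof_value_entry_inj T (m i j : 'I_3) tau :
  (i != j) || (i != m) -> Qspace (shape_deg k i j) (tau i j) ->
  (forall der s beta, in_dof_group m der i j s beta ->
     dof_value T (der, i, j, s) (mpoly.mpolyX R beta) tau = 0) ->
  tau i j = 0.
Proof.
move=> ijm /Qspace_shape taud h.
have all0 : forall lam, tensor lam (tau i j) = 0.
  move=> lam.
  apply: (tensor_separating_axes (S := fun r => axis_dofs k T i j r setT) (rs := enum 'I_3) taud).
  - by move=> r _; exact: separating_axis_dofs.
  - move=> lam' lam'S; apply: axis_dofs_dof_value ijm _ lam'S.
    by move=> der s beta _ g _; apply: h.
  - by move=> r; rewrite mem_enum.
by apply/mpoly.mpolyP => mu; rewrite mcoeffE_tensor all0 mpoly.mcoeff0.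
Qed.

Lemma trace_entry tau m : \tr tau = 0 ->
  tau m m = - \sum_(i | i != m) tau i i.
Proof. by rewrite /mxtrace (bigD1 m) //= => /eqP; rewrite addr_eq0 => /eqP. Qed.

Lemma dof_value_inj T m tau : Xi_space k tau ->
  (forall der i j s beta, in_dof_group m der i j s beta ->
     dof_value T (der, i, j, s) (mpoly.mpolyX R beta) tau = 0) ->
  tau = 0.
Proof.
move=> [tr0 taud] h.
have entry0 i j : (i != j) || (i != m) -> tau i j = 0.
  move=> ijm; apply: (dof_value_entry_inj (T := T) ijm) => //.
  by move=> der s beta; exact: h.
apply/matrixP => i j; rewrite mxE.
have [/andP[/eqP-> /eqP->]|] := boolP ((i == m) && (j == m)).
  by rewrite (trace_entry m tr0) big1 ?oppr0 // => r rm; rewrite entry0 // rm orbT.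
rewrite negb_and => ijm; apply: entry0; move: ijm.
by have [->|] := eqVneq i m; rewrite ?orbT //= orbF eq_sym.
Qed.

End Injectivity.

(** * Counting and unisolvence *)

Section Counting.
Variable R : realType.

(** The two sizes are kept apart because the number of degrees of freedom and the dimension agree
    only by a computed equation. *)
Lemma unique_row_solution n1 n2 (M : 'M[R]_(n1, n2)) : n1 = n2 ->
  (forall v : 'cV_n2, M *m v = 0 -> v = 0) ->
  forall w : 'rV_n2, exists! c : 'rV_n1, c *m M = w.
Proof.
move=> n12; subst n2 => inj w.
have : M^T \in unitmx.
  rewrite -row_free_unit; apply: inj_row_free => v vM.
  rewrite -[v]trmxK (inj v^T) ?trmx0 //.
  by apply: trmx_inj; rewrite trmx_mul trmxK vM trmx0.
rewrite unitmx_tr => Mu; exists (w *m invmx M); split; first by rewrite mulmxKV.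
by move=> c <-; rewrite mulmxK.
Qed.

(** [E] is a bare set, so the argument runs on coordinate matrices: expressing each basis in the
    other gives two matrices with product 1, which bounds one size by the other. *)
Lemma is_basis_size (V : lmodType R) (E : set V) b b' :
  is_basis E b -> is_basis E b' -> size b = size b'.
Proof.
suff le b1 b2 : is_basis E b1 -> is_basis E b2 -> (size b1 <= size b2)%N.
  by move=> bb bb'; apply/eqP; rewrite eqn_leq !le.
move=> [b1E b1x] [b2E b2x].
have b1t (t : 'I_(size b1)) : E b1`_t by apply/b1E/mem_nth.
have b2t (t : 'I_(size b2)) : E b2`_t by apply/b2E/mem_nth.
have /choice[P PE] t : exists c : 'rV[R]_(size b2),
    b1`_(t : 'I_(size b1)) = \sum_(u < size b2) c 0 u *: b2`_u.
  by have [c [cE _]] := b2x _ (b1t t); exists c.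
have /choice[Q QE] t : exists c : 'rV[R]_(size b1),
    b2`_(t : 'I_(size b2)) = \sum_(u < size b1) c 0 u *: b1`_u.
  by have [c [cE _]] := b1x _ (b2t t); exists c.
apply: (@mulmx1_min _ _ _ (\matrix_t P t) (\matrix_t Q t)).
apply/row_matrixP => t; rewrite row_mul rowK row1.
(* Row [t] of the product and the unit row are both coordinates of the same basis element. *)
have [c [_ cU]] := b1x _ (b1t t); rewrite -(cU (delta_mx 0 t)); last first.
  rewrite (bigD1 t) //= mxE !eqxx scale1r big1 ?addr0 // => u ut.
  by rewrite mxE (negPf ut) andbF scale0r.
apply/esym/cU; rewrite PE.
under eq_bigr => u _ do rewrite QE scaler_sumr.
rewrite exchange_big; apply: eq_bigr => v _ /=.
rewrite mxE scaler_suml; apply: eq_bigr => u _.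
by rewrite scalerA !mxE.
Qed.

(** Enumerating dependent finite functions makes the cardinal a product over the axes. *)
Definition box (n : 'I_3 -> nat) : seq (mpoly.multinom 3) :=
  [seq mpoly.Multinom [tuple val (f r) | r < 3]
  | f : {dffun forall r, 'I_(n r)}].

Lemma size_box n : size (box n) = (\prod_r n r)%N.
Proof.
rewrite size_map -cardE card_dep_ffun foldrE big_map big_enum.
by apply: eq_bigr => r _; rewrite card_ord.
Qed.

Lemma mem_box n mu : (mu \in box n) = [forall r, mu r < n r]%N.
Proof.
apply/mapP/forallP => [[f _ ->] r|h].
  by rewrite mpoly.multinomE tnth_mktuple ltn_ord.
exists (finfun (fun r => Ordinal (h r)) : {dffun forall r, 'I_(n r)}).
  by rewrite mem_enum.
by apply/mpoly.mnmP => r; rewrite mpoly.multinomE tnth_mktuple ffunE.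
Qed.

Lemma box_uniq n : uniq (box n).
Proof.
rewrite map_inj_uniq ?enum_uniq // => f g fg; apply/ffunP => r.
apply: val_inj; have /mpoly.mnmP/(_ r) := fg.
by rewrite !mpoly.multinomE !tnth_mktuple.
Qed.

Lemma sum_delta (I : eqType) (s : seq I) (c : I -> R) x : uniq s -> x \in s ->
  \sum_(y <- s) c y * (y == x)%:R = c x.
Proof.
move=> us xs; rewrite (bigD1_seq x) //= eqxx mulr1 big1 ?addr0 // => y /negPf ->.
by rewrite mulr0.
Qed.

Lemma mpoly_sum_box n (p : poly3 R) :
  (forall mu, mu \in mpoly.msupp p -> mu \in box n) ->
  p = \sum_(mu <- box n) mpoly.mcoeff mu p *: mpoly.mpolyX R mu.
Proof.
move=> pn; apply/mpoly.mpolyP => nu; rewrite raddf_sum /=.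
under eq_bigr => mu _ do rewrite mpoly.mcoeffZ mpoly.mcoeffX.
have [nub|] := boolP (nu \in box n); first by rewrite sum_delta ?box_uniq.
move=> nub; rewrite big_seq big1 => [|mu mub].
  by apply: mpoly.memN_msupp_eq0; apply: contra nub; exact: pn.
have [e|_] := eqVneq mu nu; last by rewrite mulr0.
by rewrite -e mub in nub.
Qed.

(** The dimension of the univariate polynomials of degree at most [d]. *)
Definition natdim (d : int) : nat := if d is Posz n then n.+1 else 0%N.

Lemma ltn_natdim a d : (a < natdim d)%N = (Posz a <= d).
Proof. by case: d. Qed.

Lemma natdimB (a b : nat) : natdim (a%:Z - b%:Z) = (a.+1 - b)%N.
Proof.
have [ba|ab] := leqP b a; first by rewrite subzn //= subSn.
have -> : a%:Z - b%:Z = Negz (b - a).-1 by lia.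
by rewrite /=; lia.
Qed.

Lemma Qspace_box (d : 'I_3 -> int) (p : poly3 R) :
  Qspace d p <->
  forall mu, mu \in mpoly.msupp p -> mu \in box (fun r => natdim (d r)).
Proof.
split=> h mu /h; rewrite mem_box.
  by move=> hr; apply/forallP => r; rewrite ltn_natdim.
by move=> /forallP hr r; rewrite -ltn_natdim.
Qed.

(** The reference against which the size of an arbitrary test basis is measured. *)
Lemma Qspace_monomials (d : 'I_3 -> int) :
  is_basis (@Qspace R d)
    [seq mpoly.mpolyX R mu | mu <- box (fun r => natdim (d r))].
Proof.
pose bx := box (fun r => natdim (d r)); rewrite -/bx.
set b := map _ _; pose mu t := nth (@mpoly.mnm0 3) bx t.
have szb : size b = size bx by rewrite size_map.
have bE (t : 'I_(size b)) : b`_t = mpoly.mpolyX R (mu t).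
  by rewrite (nth_map (@mpoly.mnm0 3)) // -szb.
have coefE (c : 'rV[R]_(size b)) (t : 'I_(size b)) :
    mpoly.mcoeff (mu t) (\sum_(u < size b) c 0 u *: b`_u) = c 0 t.
  rewrite raddf_sum /= -[RHS](sum_delta (c 0) (index_enum_uniq _)
    (mem_index_enum t)).
  apply: eq_bigr => u _; rewrite mpoly.mcoeffZ bE mpoly.mcoeffX.
  by rewrite nth_uniq -?szb ?box_uniq.
split=> [_ /mapP[nu nubx ->]|p pd].
  by apply/Qspace_box => nu'; rewrite mpoly.msuppX inE => /eqP ->.
exists (\row_t mpoly.mcoeff (mu t) p); split.
  rewrite {1}(mpoly_sum_box ((Qspace_box d p).1 pd)) -/bx.
  rewrite (big_nth (@mpoly.mnm0 3)) big_mkord -szb.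
  by apply: eq_bigr => t _; rewrite mxE bE.
by move=> c ->; apply/rowP => t; rewrite mxE coefE.
Qed.

Lemma is_basis_Qspace_size d b : is_basis (@Qspace R d) b ->
  size b = (\prod_r natdim (d r))%N.
Proof.
by move/is_basis_size/(_ (Qspace_monomials d)); rewrite size_map size_box.
Qed.

End Counting.

(** * Equality of dimensions and the dual basis *)

Section Unisolvence.
Variable R : realType.
Variables (k : nat) (m : 'I_3).
Hypothesis k3 : (3 <= k)%N.
Implicit Types (tau : 'M[poly3 R]_3).

Lemma sum_option_bool (F : option bool -> nat) :
  (\sum_o F o = F None + F (Some true) + F (Some false))%N.
Proof.
rewrite (bigD1 None) //= (bigD1 (Some true)) //= (bigD1 (Some false)) //=.
by rewrite big1 ?addn0 ?addnA // => -[[]|].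
Qed.

Lemma prodn_axis (F : 'I_3 -> nat) :
  (\prod_r F r = F axis_x * F axis_y * F axis_z)%N.
Proof.
rewrite !big_ord_recl big_ord0 muln1 mulnA.
by congr (F _ * F _ * F _)%N; apply/val_inj.
Qed.

Lemma sum_axis_side (i j r : 'I_3) der :
  (\sum_o axis_ok i j r o der * natdim (axis_test_deg k i j r o) =
   if i == j then ~~ der * k
   else if r == i then ~~ der * k.-1
   else if r == j then (if der then 2 else k.-1)
   else ~~ der * k)%N.
Proof.
rewrite sum_option_bool /axis_ok /axis_test_deg.
case: (i == j); first by rewrite (natdimB k 3); case: der => /=; lia.
case: (r == i); first by rewrite (natdimB k 2); case: der => /=; lia.
case: (r == j); first by rewrite (natdimB k 4); case: der => /=; lia.
by rewrite (natdimB k 3); case: der => /=; lia.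
Qed.

(** Off the diagonal, (k-1)(k-1)k moments of the entry and (k-1)2k of its derivative add up to
    (k-1)(k+1)k. On the diagonal the derivative term is zero and k^3 remains. *)
Lemma sum_axis_dofs (i j : 'I_3) :
  (\sum_(der : bool) \prod_r \sum_o
     axis_ok i j r o (der && (r == j)) * natdim (axis_test_deg k i j r o) =
   \prod_r (axis_deg k i j r).+1)%N.
Proof.
rewrite big_bool !prodn_axis !sum_axis_side /axis_deg.
case: k k3 => [|[|[|n]]] // _.
move: i j => [[|[|[|]]] //= ?] [[|[|[|]]] //= ?];
  rewrite !(mul0n, mul1n, add0n, muln0); lia.
Qed.

Definition carries_dofs (ij : 'I_3 * 'I_3) := (ij.1 != ij.2) || (ij.1 != m).

Lemma sum_dof_group_split (G : dof_group -> nat) :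
  (\sum_g G g = \sum_ij \sum_der \sum_s G (der, ij.1, ij.2, s))%N.
Proof.
pose h (x : ('I_3 * 'I_3) * (bool * subent)) : dof_group :=
  (x.2.1, x.1.1, x.1.2, x.2.2).
rewrite (reindex h); last first.
  exists (fun g : dof_group => ((g.1.1.2, g.1.2), (g.1.1.1, g.2))).
    by move=> [[? ?] [? ?]].
  by move=> [[[? ?] ?] ?].
rewrite -(pair_bigA _ (fun ij x => G (h (ij, x)))).
by apply: eq_bigr => ij _; rewrite -(pair_bigA _ (fun der s => G (h (ij, (der, s))))).
Qed.

Lemma sum_dof_groups :
  (\sum_(g | is_dof_group m g) \prod_r natdim (test_deg k g r) =
   \sum_(ij | carries_dofs ij) \prod_r (axis_deg k ij.1 ij.2 r).+1)%N.
Proof.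
rewrite big_mkcond [RHS]big_mkcond sum_dof_group_split.
apply: eq_bigr => -[i j] _; cbn [fst snd].
have [ijm|ijm] := boolP (carries_dofs (i, j)); last first.
  apply: big1 => der _; apply: big1 => s _.
  by rewrite is_dof_groupE -[(i != j) || _]/(carries_dofs (i, j)) (negPf ijm).
rewrite -sum_axis_dofs.
(* By distributivity, a product over the axes of sums over three positions is a sum over the 27
   subentities. *)
apply: eq_bigr => der _; rewrite bigA_distr_bigA; apply: eq_bigr => s _.
rewrite is_dof_groupE -[(i != j) || _]/(carries_dofs (i, j)) ijm big_split [RHS]/=.
have [/forallP ok|/forallPn[r /negPf nok]] :=
  boolP [forall r, axis_ok i j r (s r) (der && (r == j))].
  rewrite [X in _ = (X * _)%N]big1 => [|r _]; last by rewrite ok.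
  rewrite mul1n.
  by apply: eq_bigr => r _; rewrite test_degE.
by rewrite [X in _ = (X * _)%N](bigD1 r) //= nok.
Qed.

Definition Xi_index : seq (('I_3 * 'I_3) * mpoly.multinom 3) :=
  [seq (ij, mu) | ij <- enum carries_dofs,
     mu <- box (fun r => (axis_deg k ij.1 ij.2 r).+1)].

Lemma size_Xi_index : size Xi_index =
  (\sum_(ij | carries_dofs ij) \prod_r (axis_deg k ij.1 ij.2 r).+1)%N.
Proof.
rewrite size_allpairs_dep sumnE big_map big_enum /=.
by apply: eq_bigr => ij _; rewrite size_box.
Qed.

Lemma Xi_index_uniq : uniq Xi_index.
Proof.
apply: allpairs_uniq_dep; first exact: enum_uniq.
  by move=> ij _; exact: box_uniq.
by move=> [ij mu] [ij' mu'] _ _ [-> ->].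
Qed.

Lemma size_dofs (B : dof_group -> seq (poly3 R)) T : dof_basis k m B ->
  size (dofs m B T) = size Xi_index.
Proof.
move=> bB; rewrite size_Xi_index -sum_dof_groups size_flatten /shape -map_comp.
rewrite sumnE big_map big_enum /=; apply: eq_bigr => g gm.
rewrite size_map; case: ifP => [gv|_]; last exact: is_basis_Qspace_size (bB g gm).
(* At a vertex every test degree is 0, so the product is 1, the length of the list holding the test
   function 1. *)
rewrite big1 // => r _; move: g gm gv => [[[der i] j] s] _ /forallP/(_ r) /= fr.
by rewrite fr.
Qed.

(** Real scalars act entrywise, as in [linear_on], since the scaling of these matrices is by
    polynomials. *)
Notation scale_mx c := (map_mx (GRing.scale c)).

(** The elementary matrix at [ij], with the one at (m, m) subtracted on the diagonal to make it
    traceless. *)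
Definition Xi_sign (ij : 'I_3 * 'I_3) (a b : 'I_3) : R :=
  ((a, b) == ij)%:R - [&& ij.1 == ij.2, a == m & b == m]%:R.

Definition Xi_elt (x : ('I_3 * 'I_3) * mpoly.multinom 3) : 'M[poly3 R]_3 :=
  \matrix_(a, b) (Xi_sign x.1 a b *: mpoly.mpolyX R x.2).

Definition Xi_comb (v : ('I_3 * 'I_3) * mpoly.multinom 3 -> R) :=
  \sum_(x <- Xi_index) scale_mx (v x) (Xi_elt x).

Lemma Xi_elt_in x : x \in Xi_index -> Xi_space k (Xi_elt x).
Proof.
case/allpairsPdep=> -[i j] [mu] [ijm mub ->]; split.
  rewrite /mxtrace; under eq_bigr => a _ do rewrite mxE.
  rewrite -scaler_suml /= sumrB -[X in X *: _]/(_ - _).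
  apply/eqP; rewrite scaler_eq0; apply/orP; left; rewrite subr_eq0; apply/eqP.
  have [<-{j ijm mub}|ij] := eqVneq i j.
    rewrite (bigD1 i) //= eqxx big1 => [|a /negPf ai]; last by rewrite xpair_eqE ai.
    rewrite (bigD1 m) //= eqxx big1 => [|a /negPf ->] //.
  rewrite !big1 // => a _; rewrite xpair_eqE.
  by have [->|] := eqVneq a i; rewrite //= (negPf ij).
move=> a b; rewrite mxE /Xi_sign /=.
have shape r : shape_deg k i j r = axis_deg k i j r by exact: shape_degE.
have mu_in : Qspace (shape_deg k i j) (mpoly.mpolyX R mu).
  move=> nu; rewrite mpoly.msuppX inE => /eqP -> r; rewrite shape.
  by move: mub; rewrite mem_box => /forallP/(_ r).
(* The compensating entry (m, m) inherits its degrees from (i, i); all diagonal entries have the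
   same bounds. *)
have [ab|] := boolP [&& i == j, a == m & b == m].
  move: mu_in; case/and3P: ab => /eqP <- /eqP -> /eqP -> mu_in nu.
  move=> /mpoly.msuppZ_le /mu_in mu_in' r.
  by have := mu_in' r; rewrite /shape_deg !eqxx.
have [[-> ->]|_] := eqVneq (a, b) (i, j).
  by move=> _ nu /mpoly.msuppZ_le; exact: mu_in.
by move=> _ nu; rewrite subrr scale0r mpoly.msupp0.
Qed.

Lemma Xi_space_comb (I : eqType) (s : seq I) (v : I -> R)
    (e : I -> 'M[poly3 R]_3) : (forall x, x \in s -> Xi_space k (e x)) ->
  Xi_space k (\sum_(x <- s) scale_mx (v x) (e x)).
Proof.
elim: s => [_|x s IH es].
  rewrite big_nil; split; first by rewrite mxtrace0.
  by move=> a b nu; rewrite mxE mpoly.msupp0.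
rewrite big_cons; have [tr1 d1] := es x (mem_head _ _).
have [|tr2 d2] := IH; first by move=> y ys; apply: es; rewrite in_cons ys orbT.
split.
  rewrite mxtraceD tr2 addr0 /mxtrace; under eq_bigr do rewrite mxE.
  by rewrite -scaler_sumr -[X in _ *: X]/(\tr _) tr1 scaler0.
move=> a b nu; rewrite mxE [in X in X -> _]mxE => /mpoly.msuppD_le.
by rewrite mem_cat => /orP[/mpoly.msuppZ_le|]; [exact: d1|exact: d2].
Qed.

Lemma linear_on_comb phi (I : eqType) (s : seq I) (v : I -> R)
    (e : I -> 'M[poly3 R]_3) : linear_on (@Xi_space R k) phi ->
  (forall x, x \in s -> Xi_space k (e x)) ->
  phi (\sum_(x <- s) scale_mx (v x) (e x)) = \sum_(x <- s) v x * phi (e x).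
Proof.
move=> phil; elim: s => [_|x s IH es]; last first.
  rewrite !big_cons phil; last 2 first.
  - by apply: es; rewrite mem_head.
  - by apply: Xi_space_comb => y ys; apply: es; rewrite in_cons ys orbT.
  by rewrite IH // => y ys; apply: es; rewrite in_cons ys orbT.
rewrite !big_nil; have Xi0 : Xi_space k (0 : 'M[poly3 R]_3).
  by have := @Xi_space_comb nat [::] (fun=> 0) (fun=> 0); rewrite big_nil; apply.
(* Linearity at zero reads [phi 0 = phi 0 + phi 0]. *)
have := phil 1 _ _ Xi0 Xi0; rewrite map_mx0 addr0 mul1r => /eqP.
by rewrite -subr_eq0 opprD addNKr oppr_eq0 => /eqP.
Qed.

Lemma Xi_comb_entry v a b : carries_dofs (a, b) ->
  Xi_comb v a b = \sum_(mu <- box (fun r => (axis_deg k a b r).+1))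
    v ((a, b), mu) *: mpoly.mpolyX R mu.
Proof.
move=> abm; rewrite /Xi_comb summxE big_allpairs_dep /=.
rewrite (bigD1_seq (a, b)) ?enum_uniq ?mem_enum //= [X in _ + X]big1 ?addr0.
  apply: eq_bigr => mu _; rewrite !mxE /Xi_sign eqxx /=.
  suff -> : [&& a == b, a == m & b == m] = false by rewrite subr0 scale1r.
  by apply/negP => /and3P[ab /eqP am _]; move: abm; rewrite /carries_dofs /= ab am eqxx.
move=> [i j] /= ij; apply: big1 => mu _; rewrite !mxE /Xi_sign /= eq_sym (negPf ij).
suff -> : [&& i == j, a == m & b == m] = false by rewrite subrr scale0r scaler0.
by apply/negP => /and3P[_ /eqP am /eqP bm]; move: abm; rewrite am bm /carries_dofs /= eqxx.
Qed.

Lemma Xi_comb_coef v a b mu : ((a, b), mu) \in Xi_index ->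
  mpoly.mcoeff mu (Xi_comb v a b) = v ((a, b), mu).
Proof.
case/allpairsPdep=> -[i j] [nu] [+ + [-> -> ->]]; rewrite mem_enum => ijm nub.
rewrite Xi_comb_entry // raddf_sum /=.
under eq_bigr => mu' _ do rewrite mpoly.mcoeffZ mpoly.mcoeffX.
by rewrite (sum_delta (fun mu' => v ((i, j), mu'))) ?box_uniq.
Qed.

Lemma Xi_entries_inj tau tau' : Xi_space k tau -> Xi_space k tau' ->
  (forall a b, carries_dofs (a, b) -> tau a b = tau' a b) -> tau = tau'.
Proof.
move=> [tr _] [tr' _] eqe; apply/matrixP => a b.
have [/eqe //|] := boolP (carries_dofs (a, b)).
rewrite negb_or !negbK => /andP[/= /eqP <- /eqP ->].
rewrite (trace_entry m tr) (trace_entry m tr'); congr (- _).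
by apply: eq_bigr => r rm; apply: eqe; rewrite /carries_dofs /= rm orbT.
Qed.

Lemma Xi_comb_mcoeff tau : Xi_space k tau ->
  tau = Xi_comb (fun x => mpoly.mcoeff x.2 (tau x.1.1 x.1.2)).
Proof.
move=> tauXi; apply: Xi_entries_inj => //; first exact/Xi_space_comb/Xi_elt_in.
move=> a b abm; rewrite Xi_comb_entry //; apply: mpoly_sum_box => mu mud.
rewrite mem_box; apply/forallP => r; have := tauXi.2 a b mu mud r.
by rewrite shape_degE.
Qed.

Lemma ent_integral_sum T s (d : poly3 R) n (c : 'I_n -> R) (b : 'I_n -> poly3 R) :
  ent_integral T s (d * \sum_t c t *: b t) =
  \sum_t c t * ent_integral T s (d * b t).
Proof.
rewrite ent_integralE mulr_sumr linear_sum /=; apply: eq_bigr => t _.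
by rewrite -scalerAr linearZ /= ent_integralE.
Qed.

Lemma dof_value_linear T g p : linear_on (@Xi_space R k) (dof_value T g p).
Proof.
move=> c sigma tau _ _; case: g => [[[der i] j] s]; rewrite /dof_value !mxE.
rewrite !ent_integralE; case: der.
  by rewrite mpoly.mderivD mpoly.mderivZ mulrDl -scalerAl linearP.
by rewrite mulrDl -scalerAl linearP.
Qed.

Lemma all_flatten (I : Type) (P : pred I) (ss : seq (seq I)) :
  all P (flatten ss) = all (all P) ss.
Proof. by elim: ss => //= s ss IH; rewrite all_cat IH. Qed.

Lemma dofs_inj (B : dof_group -> seq (poly3 R)) T tau : dof_basis k m B ->
  Xi_space k tau -> all (fun phi => phi tau == 0) (dofs m B T) -> tau = 0.
Proof.
move=> bB tauXi; rewrite all_flatten all_map => /allP h.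
apply: (dof_value_inj (T := T) k3 tauXi (m := m)) => der i j s beta [gm betad].
have := h (der, i, j, s); rewrite mem_enum => /(_ gm) /=; rewrite all_map.
have betaQ : Qspace (test_deg k (der, i, j, s)) (mpoly.mpolyX R beta).
  by move=> nu; rewrite mpoly.msuppX inE => /eqP ->.
case: ifP => [/forallP sv|_] /allP hp.
  suff -> : mpoly.mpolyX R beta = 1 by apply/eqP/hp; rewrite mem_head.
  rewrite -mpoly.mpolyX0; congr (mpoly.mpolyX _ _); apply/mpoly.mnmP => r.
  have := betad r; rewrite mpoly.mnm0E /= (sv r).
  by case: (beta r).
(* The monomial is a combination of the selected test functions, so vanishing passes from these to
   it. *)
have [_ /(_ _ betaQ) [c [-> _]]] := bB _ gm.
rewrite /dof_value ent_integral_sum; apply: big1 => t _.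
have /eqP := hp _ (mem_nth 0 (ltn_ord t)); rewrite /= /dof_value => ->.
by rewrite mulr0.
Qed.

(** The matrix of the degrees of freedom on the elements [Xi_elt] is square by the count and
    injective by [dofs_inj]; the coordinates of [phi] are the unique solution of the resulting
    system. *)
Lemma unisolvent_dofs (B : dof_group -> seq (poly3 R)) T : dof_basis k m B ->
  unisolvent (@Xi_space R k) (dofs m B T).
Proof.
move=> bB; set L := dofs m B T; pose ell t := nth (fun=> 0) L t.
have ellP t : (t < size L)%N -> linear_on (@Xi_space R k) (ell t).
  move=> tL; suff : all (fun phi => `[< linear_on (@Xi_space R k) phi >]) L.
    by move/(all_nthP (fun=> 0))/(_ t tL)/asboolP.
  rewrite all_flatten all_map; apply/allP => g _ /=; rewrite all_map.
  by apply/allP => p _; apply/asboolP; exact: dof_value_linear.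
split=> // phi phil.
pose x0 : ('I_3 * 'I_3) * mpoly.multinom 3 := ((m, m), mpoly.mnm0).
pose e (x : 'I_(size Xi_index)) := nth x0 Xi_index x.
pose M := \matrix_(t < size L, x < size Xi_index) ell t (Xi_elt (e x)).
have eXi x : e x \in Xi_index by rewrite mem_nth.
have comb psi v : linear_on (@Xi_space R k) psi ->
    psi (Xi_comb v) = \sum_x v (e x) * psi (Xi_elt (e x)).
  move=> psil; rewrite /Xi_comb linear_on_comb //; last exact: Xi_elt_in.
  by rewrite (big_nth x0) big_mkord.
have Minj (v : 'cV_(size Xi_index)) : M *m v = 0 -> v = 0.
  (* The vector [v] as a function of the index; the default 0 is not reached on [Xi_index]. *)
  move=> Mv; pose w x := if insub (index x Xi_index) is Some t then v t 0 else 0.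
  have wE x : w (e x) = v x 0.
    by rewrite /w index_uniq ?Xi_index_uniq // valK.
  have tau0 : Xi_comb w = 0.
    apply: (dofs_inj bB (T := T)); first exact/Xi_space_comb/Xi_elt_in.
    apply/(all_nthP (fun=> 0)) => t tL; rewrite -/(ell t) comb; last exact: ellP.
    have /matrixP/(_ (Ordinal tL) 0) := Mv; rewrite !mxE => Mvt; apply/eqP.
    rewrite -[RHS]Mvt.
    by apply: eq_bigr => x _; rewrite wE mxE mulrC.
  apply/colP => x; rewrite mxE -wE.
  have := eXi x; case: (e x) => [[a b] mu] /(Xi_comb_coef w) <-.
  by rewrite tau0 mxE mpoly.mcoeff0.
have [c [cM cU]] :=
  unique_row_solution (size_dofs T bB) Minj (\row_x phi (Xi_elt (e x))).
have solP (c' : 'rV[R]_(size L)) : (forall tau, Xi_space k tau ->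
    phi tau = \sum_(t < size L) c' 0 t * ell t tau) <->
    c' *m M = \row_x phi (Xi_elt (e x)).
  split=> [h|/rowP h tau tauXi].
    apply/rowP => x; rewrite !mxE h; last exact/Xi_elt_in/eXi.
    by apply: eq_bigr => t _; rewrite mxE.
  rewrite (Xi_comb_mcoeff tauXi); set v := (fun x => _); rewrite comb //.
  transitivity (\sum_(t < size L) \sum_x
      c' 0 t * (v (e x) * ell t (Xi_elt (e x)))).
    rewrite exchange_big; apply: eq_bigr => x _ /=.
    have := h x; rewrite !mxE => <-; rewrite mulr_sumr; apply: eq_bigr => t _.
    by rewrite !mxE mulrCA.
  by apply: eq_bigr => t _; rewrite comb ?mulr_sumr //; exact: ellP.
by exists c; split=> [|c' /solP]; [exact/solP|exact: cU].
Qed.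

End Unisolvence.

(** * Measure and integration on R3 *)

Section Measurability.
Variable R : realType.
Implicit Types (x y : R3 R) (r j : 'I_3).

Definition mk3 (f : 'I_3 -> R) : R3 R := (f axis_x, f axis_y, f axis_z).

Lemma coord3_mk3 f r : coord3 (mk3 f) r = f r.
Proof. by move: r; apply/forall_axis; split. Qed.

Lemma mk3_coord3 x : mk3 (coord3 x) = x.
Proof. by case: x => [[]]. Qed.

Lemma coord3_inj x y : (forall r, coord3 x r = coord3 y r) -> x = y.
Proof. by move=> h; rewrite -(mk3_coord3 x) -(mk3_coord3 y) /mk3 !h. Qed.

Lemma nbhs3P x (U : set (R3 R)) : nbhs x U <->
  exists2 e : R, 0 < e &
    forall y, (forall r, `|coord3 x r - coord3 y r| < e) -> U y.
Proof.
split=> [/nbhs_ballP[e /= e0 eU]|[e e0 eU]].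
  exists e => // y /forall_axis[hx hy hz]; apply: eU.
  by split; [split|].
apply/nbhs_ballP; exists e => //= y [[hx hy] hz]; apply: eU.
by apply/forall_axis; split.
Qed.

Lemma continuous_coord3 r : continuous (fun x : R3 R => coord3 x r).
Proof.
move: r; apply/forall_axis; split => x.
- by apply: (cvg_comp fst fst); exact: cvg_fst.
- by apply: (cvg_comp fst snd); [exact: cvg_fst|exact: cvg_snd].
- exact: cvg_snd.
Qed.

Lemma measurable_coord3 r : measurable_fun setT (fun x : R3 R => coord3 x r).
Proof.
move: r; apply/forall_axis; split.
- exact: (measurableT_comp measurable_fst measurable_fst).
- exact: (measurableT_comp measurable_snd measurable_fst).
- exact: measurable_snd.
Qed.

Lemma measurable_box3 (I : 'I_3 -> interval R) :
  measurable [set x : R3 R | forall r, coord3 x r \in I r].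
Proof.
rewrite (_ : mkset _ = \bigcap_(r in [set: 'I_3])
    ((fun x : R3 R => coord3 x r) @^-1` [set` I r])).
  apply: fin_bigcap_measurable => [|r _]; first exact: finite_finset.
  by rewrite -[X in measurable X]setTI; apply: measurable_coord3.
by apply/seteqP; split=> x /= h r; [move=> _; exact: h|exact: h].
Qed.

(** An open set is the countable union of the rational boxes inside it, which links the topology to
    the product sigma-algebra. *)
Lemma open_measurable3 (U : set (R3 R)) : open U -> measurable U.
Proof.
rewrite openE => oU.
pose bx (q : {ffun 'I_3 -> rat * rat}) :=
  [set x : R3 R | forall r, coord3 x r \in `]ratr (q r).1, ratr (q r).2[].
rewrite (_ : U = \bigcup_(q : {ffun 'I_3 -> rat * rat})
    (if `[< bx q `<=` U >] then bx q else set0)).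
  apply: countable_bigcupT_measurable => [|q]; first exact: countableP.
  by case: ifP => // _; exact: measurable_box3.
apply/seteqP; split=> [x /oU /nbhs3P[e e0 eU]|x [q _]]; last first.
  by case: ifPn => // /asboolP; apply.
have /choice[q hq] r : exists q : rat * rat,
    [/\ coord3 x r - e < ratr q.1, ratr q.1 < coord3 x r,
        coord3 x r < ratr q.2 & ratr q.2 < coord3 x r + e].
  have [|q1] := @rat_in_itvoo R (coord3 x r - e) (coord3 x r).
    by rewrite ltrBlDr ltrDl.
  rewrite in_itv /= => /andP[h1 h2].
  have [|q2] := @rat_in_itvoo R (coord3 x r) (coord3 x r + e).
    by rewrite ltrDl.
  rewrite in_itv /= => /andP[h3 h4].
  by exists (q1, q2).
have bxU : bx [ffun r => q r] `<=` U.
  move=> y yb; apply: eU => r; have := yb r; rewrite ffunE in_itv /=.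
  have [h1 h2 h3 h4] := hq r => /andP[h5 h6].
  by rewrite ltr_norml; apply/andP; split; lra.
exists [ffun r => q r] => //; rewrite asboolT // => r.
by have [h1 h2 h3 h4] := hq r; rewrite ffunE in_itv /= h2.
Qed.

Lemma continuous_measurable3 (f : R3 R -> R) :
  continuous f -> measurable_fun setT f.
Proof.
move=> cf; apply: (measurability _ (measurable_realfun.RGenOpens.measurableE R)) => //.
move=> _ [_ [a [b ->]] <-]; rewrite setTI; apply: open_measurable3.
by apply: open_comp => //; exact: interval_open.
Qed.

Lemma leb3_setX (A B C : set R) :
  measurable A -> measurable B -> measurable C ->
  (@leb3 R ((A `*` B) `*` C) =
   @lebesgue_measure R A * @lebesgue_measure R B * @lebesgue_measure R C)%E.
Proof.
move=> mA mB mC.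
transitivity ((@lebesgue_measure R \x @lebesgue_measure R) (A `*` B) *
  @lebesgue_measure R C)%E.
  exact: (@product_measure1E _ _ _ _ R (@lebesgue_measure R \x
    @lebesgue_measure R)%E (@lebesgue_measure R) _ _ (measurableX mA mB) mC).
congr (_ * _)%E.
exact: (@product_measure1E _ _ _ _ R (@lebesgue_measure R)
  (@lebesgue_measure R) _ _ mA mB).
Qed.

Lemma leb3_box_lty (c : R) :
  (@leb3 R [set x : R3 R | forall r, coord3 x r \in `[(- c)%R, c]] < +oo)%E.
Proof.
rewrite (_ : mkset _ = (`[- c, c] `*` `[- c, c]) `*` `[- c, c]).
  rewrite leb3_setX // !lebesgue_measure_itv /=.
  by case: ifP => _; rewrite -?EFinB -?EFinM ?mule0 ltry.
apply/seteqP; split=> [x /forall_axis[] | x [[hx hy] hz]] //=.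
by apply/forall_axis; split.
Qed.

Definition bounded_support (f : R3 R -> R) :=
  exists c : R, forall x, f x != 0 -> forall r, `|coord3 x r| <= c.

Definition bounded_by (f : R3 R -> R) := exists M : R, forall x, `|f x| <= M.

Lemma integrable_bounded_support (f : R3 R -> R) :
  measurable_fun setT f -> bounded_by f -> bounded_support f ->
  (@leb3 R).-integrable setT (EFin \o f).
Proof.
move=> mf [M fM] [c fc].
pose D := [set x : R3 R | forall r, coord3 x r \in `[- c, c]].
have mD : measurable D := @measurable_box3 (fun=> `[- c, c]).
have fD : f = f \_ D.
  apply/funext => x; rewrite patchE; case: ifPn => // xD.
  apply/eqP; apply: contrapT => /negP f0; move/negP: xD; apply.
  by rewrite inE => r; rewrite in_itv /= -ler_norml; exact: fc.
rewrite fD -restrict_EFin -integrable_mkcond //.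
apply: measurable_bounded_integrable => //; first exact: leb3_box_lty.
  exact: measurable_funTS.
exists M; split; first exact: num_real.
by move=> M' MM' x _ /=; rewrite (le_trans (fM x)) ?ltW.
Qed.

Lemma Lfun2_bounded_support (f : R3 R -> R) :
  measurable_fun setT f -> bounded_by f -> bounded_support f ->
  f \in Lfun (@leb3 R) 2%:E.
Proof.
move=> mf [M fM] [c fc]; rewrite inE; apply/andP; split; rewrite inE //=.
have : (@leb3 R).-integrable setT (EFin \o (fun x => `|f x| `^ 2)).
  apply: integrable_bounded_support.
  - apply: (@measurableT_comp _ _ _ _ _ _ (fun x : R => x `^ 2)%R) => //.
    exact/measurableT_comp.
  - exists (M `^ 2) => x; rewrite ger0_norm ?powR_ge0 //.
    apply: ge0_ler_powR => //; rewrite ?nnegrE //.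
    exact: le_trans (fM x).
  - exists c => x h; apply: fc; apply: contra_neq h => ->.
    by rewrite normr0 powR0 // pnatr_eq0.
move/integrableP => [_ i2]; rewrite /finite_norm unlock poweR_lty //.
apply: le_lt_trans i2; rewrite le_eqVlt; apply/orP; left; apply/eqP.
by apply: eq_integral => x _ /=; rewrite [in RHS]ger0_norm ?powR_ge0.
Qed.

(** As [t] varies, the line through [x] parallel to [x_j], parametrised by its own coordinate. *)
Definition upd x j (t : R) : R3 R := mk3 (with_axis j t (coord3 x)).

Lemma coord3_upd x j t r :
  coord3 (upd x j t) r = if r == j then t else coord3 x r.
Proof. by rewrite coord3_mk3. Qed.

Lemma product_integral_lines1_eq0 d1 d2 (T1 : measurableType d1)
    (T2 : measurableType d2) (m1 : {sigma_finite_measure set T1 -> \bar R})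
    (m2 : {sigma_finite_measure set T2 -> \bar R}) (h : T1 * T2 -> \bar R) :
  (m1 \x m2)%E.-integrable setT h ->
  (forall u, \int[m2]_v h (u, v) = 0)%E -> (\int[m1 \x m2]_p h p = 0)%E.
Proof.
move=> hi h0; rewrite -integral12_prod_meas1 //.
by apply: integral0_eq => x _; exact: h0.
Qed.

(** The hypothesis holds only almost everywhere because the inner integral may itself call for
    Fubini, and sections are integrable only for almost every value of the fixed variable. *)
Lemma product_integral_lines2_eq0 d1 d2 (T1 : measurableType d1)
    (T2 : measurableType d2) (m1 : {sigma_finite_measure set T1 -> \bar R})
    (m2 : {sigma_finite_measure set T2 -> \bar R}) (h : T1 * T2 -> \bar R) :
  (m1 \x m2)%E.-integrable setT h ->
  {ae m2, forall v, (\int[m1]_u h (u, v) = 0)%E} ->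
  (\int[m1 \x m2]_p h p = 0)%E.
Proof.
move=> hi h0; rewrite -integral21_prod_meas1 //.
rewrite (@ae_eq_integral _ _ _ m2 setT (cst 0%E)) ?integral0 //.
  exact: (measurable_fubini_G hi).
by apply: filterS h0 => y hy _; exact: hy.
Qed.

(* The canonical sigma-finite structure of a product measure found by
   unification is the one for subprobabilities, hence this copy. *)
Definition leb2 : set (measurableTypeR R * measurableTypeR R) -> \bar R :=
  (@lebesgue_measure R \x @lebesgue_measure R)%E.

HB.instance Definition _ := Measure.on leb2.

Lemma leb2_sigma_finite : sigma_finite setT leb2.
Proof.
pose I (n : nat) : set R := [set` `[- n%:R, n%:R]].
have inI (a : R) (n : nat) : (Num.bound `|a| <= n)%N -> I n a.
  move=> an; rewrite /I /= in_itv /= -ler_norml ltW //.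
  by rewrite (lt_le_trans (archi_boundP (normr_ge0 a))) ?ler_nat.
exists (fun n => I n `*` I n) => [|n].
  apply/seteqP; split=> // -[a b] _.
  exists (maxn (Num.bound `|a : R|) (Num.bound `|b : R|)) => //.
  split; [exact: (inI a _ (leq_maxl _ _))|exact: (inI b _ (leq_maxr _ _))].
have mI : measurable (I n : set (measurableTypeR R)) by exact: measurable_itv.
split; first exact: measurableX.
have -> : leb2 (I n `*` I n) =
    (@lebesgue_measure R (I n) * @lebesgue_measure R (I n))%E.
  exact: (@product_measure1E _ _ _ _ R (@lebesgue_measure R)
    (@lebesgue_measure R) _ _ mI mI).
rewrite /I !lebesgue_measure_itv /=.
by case: ifP => _; rewrite -?EFinB -?EFinM ?mule0 ltry.
Qed.

HB.instance Definition _ :=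
  Measure_isSigmaFinite.Build _ _ _ leb2 leb2_sigma_finite.

Lemma leb3_integral_lines_eq0 j (f : R3 R -> R) :
  (@leb3 R).-integrable setT (EFin \o f) ->
  (forall x, (\int[@lebesgue_measure R]_t (f (upd x j t))%:E = 0)%E) ->
  (\int[@leb3 R]_x (f x)%:E = 0)%E.
Proof.
move=> fi h; pose l := @lebesgue_measure R.
have {}fi : (leb2 \x l)%E.-integrable setT (EFin \o f) := fi.
suff : (\int[leb2 \x l]_x (EFin \o f) x = 0)%E by [].
have [jE|[jE|jE]] : j = axis_x \/ j = axis_y \/ j = axis_z.
- by move: j {h}; apply/forall_axis; split; auto.
- apply: (product_integral_lines2_eq0 fi).
  have := ae_integrable2 fi; apply: filterS => z iz.
  apply: (@product_integral_lines2_eq0 _ _ _ _ l l _ iz); apply: aeW => y.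
  (* The coordinate along [j] is overwritten by [upd], so 0 is a placeholder. *)
  by move: (h (0, y, z)); rewrite jE.
- apply: (product_integral_lines2_eq0 fi).
  have := ae_integrable2 fi; apply: filterS => z iz.
  apply: (@product_integral_lines1_eq0 _ _ _ _ l l _ iz) => x.
  by move: (h (x, 0, z)); rewrite jE.
- apply: (product_integral_lines1_eq0 fi) => -[x y].
  by move: (h (x, y, 0)); rewrite jE.
Qed.

End Measurability.

(** * Geometry of the mesh *)

Section MeshGeometry.
Variables (R : realType) (Omega : set (R3 R)) (n : nat) (Th : 'I_n -> cuboid R).
Hypothesis mesh : cuboid_mesh Omega Th.
Hypothesis openO : open Omega.
Implicit Types (x : R3 R) (r j : 'I_3) (a b : 'I_n).

Definition half_cell (T : cuboid R) : set (R3 R) :=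
  [set x | forall r, coord3 x r \in `[lo T r, hi T r[].

Lemma cell_inj a b (t : 'I_3 -> R) :
  (forall r, [/\ lo (Th a) r < t r < hi (Th a) r &
                 lo (Th b) r < t r < hi (Th b) r]) -> a = b.
Proof.
move=> h; apply/eqP; apply: contrapT => /negP ab.
have [_ /(_ a b ab) + _] := mesh; rewrite -subset0 => /(_ (mk3 t)); apply.
by split=> r; rewrite coord3_mk3; case: (h r).
Qed.

(** The witness is the midpoint of [t] and the smaller upper end. It turns a common point of
    half-open intervals into a common interior point, where disjointness of the open cells
    applies. *)
Lemma half_open_overlap (la ha lb hb t : R) :
  t \in `[la, ha[ -> t \in `[lb, hb[ ->
  exists s, [/\ la < s < ha, lb < s < hb & t < s].
Proof.
rewrite !in_itv /= => /andP[h1 h2] /andP[h3 h4].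
exists ((t + Num.min ha hb) / 2).
have [h|h] := leP ha hb; split; try (apply/andP; split); lra.
Qed.

Lemma half_cell_inj a b x : half_cell (Th a) x -> half_cell (Th b) x -> a = b.
Proof.
move=> ha hb; have /choice[t ht] r := half_open_overlap (ha r) (hb r).
by apply: (@cell_inj a b t) => r; have [] := ht r.
Qed.

Definition half_open (sgn : bool) (l h : R) : interval R :=
  if sgn then `[l, h[ else `]l, h].

(* Pushing x into the octant sgn stays in Omega, hence in finitely many closed
   cells; one of them is met by arbitrarily small displacements. *)
Lemma Omega_half_open x (sgn : 'I_3 -> bool) : Omega x ->
  exists a, forall r, coord3 x r \in half_open (sgn r) (lo (Th a) r) (hi (Th a) r).
Proof.
move=> Ox; apply: contrapT => nh.
pose y (d : R) := mk3 (fun r => coord3 x r + (-1) ^+ (~~ sgn r) * d).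
have out a : \forall d \near 0^'+, ~ cell (Th a) (y d).
  have [r hr] : exists r,
      coord3 x r \notin half_open (sgn r) (lo (Th a) r) (hi (Th a) r).
    apply: contrapT => h; apply: nh; exists a => r; apply: contrapT => /negP h'.
    by apply: h; exists r.
  have [e e0 eP] : exists2 e : R, 0 < e & forall d, 0 < d < e ->
      ~ (lo (Th a) r <= coord3 x r + (-1) ^+ (~~ sgn r) * d <= hi (Th a) r).
    move: hr; rewrite /half_open; case: (sgn r); rewrite in_itv /= negb_and.
      rewrite -ltNge -leNgt => /orP[h|h].
        exists (lo (Th a) r - coord3 x r); first by rewrite subr_gt0.
        by move=> d /andP[h1 h2] /andP[h3 h4]; lra.
      by exists 1 => // d /andP[h1 h2] /andP[h3 h4]; lra.
    rewrite -leNgt -ltNge => /orP[h|h].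
      by exists 1 => // d /andP[h1 h2] /andP[h3 h4]; lra.
    exists (coord3 x r - hi (Th a) r); first by rewrite subr_gt0.
    by move=> d /andP[h1 h2] /andP[h3 h4]; lra.
  near=> d => /(_ r); rewrite coord3_mk3; apply: eP.
  by apply/andP; split; near: d; [exact: nbhs_right_gt|exact: nbhs_right_lt].
have inO : \forall d \near 0^'+, Omega (y d).
  have /nbhs3P[e e0 eO] : nbhs x Omega by apply: open_nbhs_nbhs.
  near=> d; apply: eO => r; rewrite coord3_mk3 opprD addNKr normrN normrM.
  rewrite normrX normrN1 expr1n mul1r ger0_norm; near: d.
    exact: nbhs_right_lt.
  exact: nbhs_right_ge.
have outs : \forall d \near 0^'+, forall a, ~ cell (Th a) (y d).
  exact: (filter_forall (f := fun a d => ~ cell (Th a) (y d)) _ out).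
near (0 : R)^'+ => d.
have Oyd : Omega (y d) by near: d; exact: inO.
have nyd : forall a, ~ cell (Th a) (y d) by near: d; exact: outs.
have [clO _ _] := mesh.
have : closure Omega (y d) by exact: subset_closure.
by rewrite clO => -[a _]; exact: nyd.
Unshelve. all: by end_near. Qed.

(* The cells crossed by the line through x parallel to the axis j. *)
Definition active j x a := forall r, r != j ->
  coord3 x r \in `[lo (Th a) r, hi (Th a) r[.

Lemma cell_upd j x a t : active j x a -> lo (Th a) j <= t <= hi (Th a) j ->
  cell (Th a) (upd x j t).
Proof.
move=> act ht r; rewrite coord3_upd; case: eqP => [->//|/eqP rj].
by have := act r rj; rewrite in_itv /= => /andP[-> /ltW ->].
Qed.

Lemma active_overlap j x a b t : active j x a -> active j x b ->
  lo (Th a) j < t < hi (Th a) j -> lo (Th b) j < t < hi (Th b) j -> a = b.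
Proof.
move=> aa ab ta tb.
have /choice[s hs] r : exists s, [/\ lo (Th a) r < s < hi (Th a) r &
                 lo (Th b) r < s < hi (Th b) r].
  have [->|rj] := eqVneq r j; first by exists t.
  by have [s []] := half_open_overlap (aa r rj) (ab r rj); exists s.
exact: cell_inj hs.
Qed.

Lemma active_hi_inj j x a b : active j x a -> active j x b ->
  hi (Th a) j = hi (Th b) j -> a = b.
Proof.
move=> aa ab hh; have la := lo_lt_hi (Th a) j; have lb := lo_lt_hi (Th b) j.
apply: (@active_overlap j x a b
  ((Num.max (lo (Th a) j) (lo (Th b) j) + hi (Th a) j) / 2)) => //.
all: have [h|h] := leP (lo (Th a) j) (lo (Th b) j); apply/andP; split; lra.
Qed.

Lemma active_lo_inj j x a b : active j x a -> active j x b ->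
  lo (Th a) j = lo (Th b) j -> a = b.
Proof.
move=> aa ab hh; have la := lo_lt_hi (Th a) j; have lb := lo_lt_hi (Th b) j.
apply: (@active_overlap j x a b
  ((Num.min (hi (Th a) j) (hi (Th b) j) + lo (Th a) j) / 2)) => //.
all: have [h|h] := leP (hi (Th a) j) (hi (Th b) j); apply/andP; split; lra.
Qed.

(** The intersection of the closed cells is a subentity of [Th a]. It is free along [r], so it
    contains the whole side of [Th a], which therefore lies within that of [Th b]. *)
Lemma active_match_sub j x a b t r : r != j -> active j x a -> active j x b ->
  lo (Th a) j <= t <= hi (Th a) j -> lo (Th b) j <= t <= hi (Th b) j ->
  lo (Th b) r <= lo (Th a) r /\ hi (Th a) r <= hi (Th b) r.
Proof.
move=> rj aa ab ta tb; pose y := upd x j t.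
have [_ _ /(_ a b)] := mesh.
case=> [|s [_ [sE _]]]; first by exists y; split; exact: cell_upd.
have ys : subent_set (Th a) s y by rewrite -sE; split; exact: cell_upd.
have yr : coord3 y r = coord3 x r by rewrite coord3_upd (negPf rj).
have upd_in u : lo (Th a) r <= u <= hi (Th a) r ->
    lo (Th b) r <= u <= hi (Th b) r -> subent_set (Th a) s (upd y r u).
  move=> ua ub; rewrite -sE; split=> r'; rewrite coord3_upd;
    case: eqP => [->//|_]; exact: cell_upd.
have [u [ua ub xu]] := half_open_overlap (aa r rj) (ab r rj).
(* The subentity contains points with the distinct coordinates [coord3 x r < u], so it is not pinned
   along [r]. *)
have sr : s r = None.
  case E : (s r) => [e|//].
  have ue : u = endpoint (Th a) r e.
    have : subent_set (Th a) s (upd y r u).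
      by apply: upd_in; rewrite !ltW //; [case/andP: ua|case/andP: ua|
        case/andP: ub|case/andP: ub].
    by move=> /(_ r); rewrite /= E coord3_upd eqxx.
  have := ys r; rewrite /= E yr -ue => xue.
  by rewrite xue ltxx in xu.
have upd_b u' : lo (Th a) r <= u' <= hi (Th a) r ->
    lo (Th b) r <= u' <= hi (Th b) r.
  move=> ua'; have : subent_set (Th a) s (upd y r u').
    move=> r'; rewrite coord3_upd; case: eqP => [->|_]; first by rewrite sr.
    exact: ys.
  by rewrite -sE => -[_ /(_ r)]; rewrite coord3_upd eqxx.
have lr := ltW (lo_lt_hi (Th a) r).
split.
  by have /upd_b/andP[] : lo (Th a) r <= lo (Th a) r <= hi (Th a) r
    by rewrite lexx.
by have /upd_b/andP[] : lo (Th a) r <= hi (Th a) r <= hi (Th a) r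
  by rewrite lexx andbT.
Qed.

Lemma active_match j x a b r : r != j -> active j x a -> active j x b ->
  hi (Th a) j = lo (Th b) j ->
  lo (Th a) r = lo (Th b) r /\ hi (Th a) r = hi (Th b) r.
Proof.
move=> rj aa ab hab.
have ta : lo (Th a) j <= hi (Th a) j <= hi (Th a) j by rewrite lexx ltW ?lo_lt_hi.
have tb : lo (Th b) j <= hi (Th a) j <= hi (Th b) j.
  by rewrite hab lexx ltW ?lo_lt_hi.
have [h1 h2] := active_match_sub rj aa ab ta tb.
have [h3 h4] := active_match_sub rj ab aa tb ta.
by split; apply/eqP; rewrite eq_le ?h1 ?h2 ?h3 ?h4.
Qed.

Lemma active_right j x a : active j x a -> Omega (upd x j (hi (Th a) j)) ->
  exists2 b, active j x b & hi (Th a) j = lo (Th b) j.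
Proof.
move=> aa Oy; have [b hb] := Omega_half_open (fun=> true) Oy.
have ab : active j x b.
  by move=> r rj; have := hb r; rewrite coord3_upd (negPf rj).
exists b => //; have := hb j; rewrite coord3_upd eqxx in_itv /= => /andP[h1 h2].
apply/eqP; rewrite eq_le h1 andbT leNgt; apply/negP => h3.
have la := lo_lt_hi (Th a) j.
suff e : a = b by rewrite e ltxx in h2.
apply: (@active_overlap j x a b
  ((Num.max (lo (Th a) j) (lo (Th b) j) + hi (Th a) j) / 2)) => //.
all: have [h|h] := leP (lo (Th a) j) (lo (Th b) j); apply/andP; split; lra.
Qed.

(** The cell on the other side meets the point at its upper end, hence the reversed orientation
    along [x_j]; the other axes keep the orientation that defines [active]. *)
Lemma active_left j x b : active j x b -> Omega (upd x j (lo (Th b) j)) ->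
  exists2 a, active j x a & hi (Th a) j = lo (Th b) j.
Proof.
move=> ab Oy; have [a ha] := Omega_half_open (fun r => r != j) Oy.
have aa : active j x a.
  by move=> r rj; have := ha r; rewrite coord3_upd (negPf rj).
exists a => //; have := ha j; rewrite coord3_upd eqxx /half_open in_itv /= => /andP[h1 h2].
apply/eqP; rewrite eq_le h2 andbT leNgt; apply/negP => h3.
have lb := lo_lt_hi (Th b) j.
suff e : a = b by rewrite e ltxx in h1.
apply: (@active_overlap j x a b
  ((Num.min (hi (Th a) j) (hi (Th b) j) + lo (Th b) j) / 2)) => //.
all: have [h|h] := leP (hi (Th a) j) (hi (Th b) j); apply/andP; split; lra.
Qed.

End MeshGeometry.

(** * Continuity across faces *)

Section FaceContinuity.
Variables (R : realType) (k : nat) (m : 'I_3).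
Hypothesis k3 : (3 <= k)%N.
Implicit Types (T : cuboid R) (i j r f : 'I_3) (tau : 'M[poly3 R]_3).

Definition same_face_dofs T T' tau tau' := forall der i j s s' p,
  is_dof_group m (der, i, j, s) -> is_dof_group m (der, i, j, s') ->
  ~~ is_cell s -> subent_set T s = subent_set T' s' ->
  Qspace (test_deg k (der, i, j, s)) p ->
  dof_value T (der, i, j, s) p tau = dof_value T' (der, i, j, s') p tau'.

(** The normal axis is frozen at the common end and the two others are freed. The case [f = i] is
    excluded off the diagonal because no degree of freedom sits at an end along [x_i]. *)
Lemma face_continuity_entry T T' f tau tau' i j :
  (forall r, r != f -> lo T r = lo T' r /\ hi T r = hi T' r) ->
  hi T f = lo T' f -> Xi_space k tau -> Xi_space k tau' ->
  same_face_dofs T T' tau tau' ->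
  (i != j) || (i != m) -> (i == j) || (f != i) ->
  forall y, coord3 y f = hi T f -> peval (tau i j) y = peval (tau' i j) y.
Proof.
move=> TT' fTT' [_ taud] [_ tau'd] same ijm ijf y yf.
(* Only degrees of freedom on the upper face of [T] are used; their partners in [T'] sit at the
   lower end. *)
pose O := with_axis f [set Some true] (fun=> setT).
have pd : Qspace (fun r => axis_deg k i j r) (tau i j - tau' i j).
  apply: Qspace_shape => // mu /mpoly.msuppB_le; rewrite mem_cat.
  by case/orP; [exact: taud|exact: tau'd].
suff all0 : tensor (fun r n => coord3 y r ^+ n) (tau i j - tau' i j) = 0.
  by apply/eqP; rewrite /peval -subr_eq0 -mpoly.mevalB mevalE_tensor all0.
apply: (tensor_separating_axes (S := fun r => axis_dofs k T i j r (O r))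
  (rs := [seq r <- enum 'I_3 | r != f]) pd).
- move=> r; rewrite mem_filter => /andP[rf _].
  by rewrite /O /with_axis (negPf rf); exact: separating_axis_dofs.
- move=> lam lamS; apply: (@axis_dofs_tensor _ k T i j O) lamS.
  move=> der s beta sO ok bd lamE.
  have sf : s f = Some true by have := sO f; rewrite /O /with_axis eqxx.
  pose s' : subent := [ffun r => if r == f then Some false else s r].
  pose beta' := mpoly.Multinom [tuple beta r | r < 3].
  have b'E r : beta' r = beta r by rewrite mpoly.multinomE tnth_mktuple.
  have ok' r : axis_ok i j r (s' r) (der && (r == j)).
    by rewrite ffunE; case: eqP => // ->; have := ok f; rewrite sf.
  have side_eq r : side T' (s' r) r =1 side T (s r) r.
    move=> q; rewrite ffunE; have [->|rf] := eqVneq r f.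
      by rewrite sf /= /endpoint fTT'.
    by have [lr hr] := TT' r rf; rewrite /side /endpoint lr hr.
  have lamE' : lam = fun r => axis_dof T r (s r) (der && (r == j)) (beta' r).
    by apply/funext => r; rewrite lamE b'E.
  have := same der i j s s' (mpoly.mpolyX R beta'); rewrite !is_dof_groupE ijm !andTb.
  have -> : dof_value T' (der, i, j, s') (mpoly.mpolyX R beta') tau' =
      tensor lam (tau' i j).
    rewrite dof_valueX lamE'; apply: eq_tensor => r n.
    by rewrite /axis_dof !side_eq.
  rewrite dof_valueX -lamE' => eq_dof.
  rewrite raddfB /= eq_dof ?subrr //.
  + exact/forallP.
  + exact/forallP.
  + by apply/forallPn; exists f; rewrite /is_free sf.
  + apply/seteqP; split=> x xs r; have := xs r; rewrite ffunE.
      case: eqP => [->|/eqP rf]; first by rewrite sf /= fTT'.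
      by have [lr hr] := TT' r rf; rewrite /endpoint lr hr.
    case: eqP => [->|/eqP rf]; first by rewrite sf /= fTT'.
    by have [lr hr] := TT' r rf; rewrite /endpoint lr hr.
  + move=> mu; rewrite mpoly.msuppX inE => /eqP -> r.
    by rewrite b'E test_degE.
- move=> r; rewrite mem_filter mem_enum andbT negbK => /eqP ->.
  (* Evaluation at the end is itself an admissible functional along [f], tested against the constant
     1. *)
  exists (Some true), false, 0%N; split=> //.
  + by rewrite /O /with_axis eqxx.
  + move: ijf; rewrite /axis_ok; case: (i == j) => //= fi.
    by rewrite (negPf fi); case: (f == j).
  + by apply/funext => n; rewrite /axis_dof /= addn0 hornerXn yf.
Qed.

Lemma face_continuity T T' f tau tau' :
  (forall r, r != f -> lo T r = lo T' r /\ hi T r = hi T' r) ->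
  hi T f = lo T' f -> Xi_space k tau -> Xi_space k tau' ->
  same_face_dofs T T' tau tau' ->
  forall i y, coord3 y f = hi T f -> peval (tau i f) y = peval (tau' i f) y.
Proof.
move=> TT' fTT' tauXi tau'Xi same i y yf.
have entry := face_continuity_entry TT' fTT' tauXi tau'Xi same.
have [|] := boolP ((i != f) || (i != m)) => ifm.
  by apply: entry => //; rewrite eq_sym orbN.
move: ifm; rewrite negb_or !negbK => /andP[/eqP -> /eqP fm].
rewrite (trace_entry f tauXi.1) (trace_entry f tau'Xi.1) /peval.
rewrite !mpoly.mevalN; congr (- _); rewrite !raddf_sum; apply: eq_bigr => r rf.
by apply: entry => //; rewrite ?eqxx // -fm rf orbT.
Qed.

End FaceContinuity.

(** * Calculus on lines *)

Section LineCalculus.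
Variable R : realType.
Implicit Types (x y : R3 R) (j r : 'I_3) (p : poly3 R) (phi : R3 R -> R).

Lemma upd_shift x j (t h : R) : h *: unit_vec R j + upd x j t = upd x j (h + t).
Proof.
apply: coord3_inj => r; rewrite coord3_upd.
have -> : coord3 (h *: unit_vec R j + upd x j t) r =
    h * (j == r)%:R + coord3 (upd x j t) r.
  by move: r; apply/forall_axis; split.
by rewrite coord3_upd eq_sym; case: eqP => _; rewrite ?mulr1 ?mulr0 ?add0r.
Qed.

Lemma is_derive_line phi x j (t : R) : derivable phi (upd x j t) (unit_vec R j) ->
  is_derive t (1 : R) (fun u => phi (upd x j u)) (partial j phi (upd x j t)).
Proof.
have E : (fun h : R => h^-1 *: (((fun u => phi (upd x j u)) \o shift t) (h *: 1)
      - phi (upd x j t))) =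
    (fun h : R => h^-1 *: ((phi \o shift (upd x j t)) (h *: unit_vec R j)
      - phi (upd x j t))).
  by apply/funext => h /=; rewrite upd_shift [h *: 1]mulr1.
move=> dphi; apply: DeriveDef; first by rewrite /derivable E.
by rewrite /partial /derive E.
Qed.

(** The restriction of [p] to a line as a univariate polynomial, whose analytic derivative is the
    formal one. *)
Definition line_poly p x j : {poly R} :=
  \sum_(mu <- mpoly.msupp p)
    (mpoly.mcoeff mu p * \prod_(r | r != j) coord3 x r ^+ mu r) *: 'X^(mu j).

Lemma peval_upd p x j t :
  peval p (upd x j t) = tensor (with_axis j (fun n => t ^+ n)
    (fun r n => coord3 x r ^+ n)) p.
Proof.
rewrite /peval mevalE_tensor; apply: eq_tensor => r n; rewrite coord3_upd.
by rewrite /with_axis; case: eqP.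
Qed.

Lemma line_poly_horner p x j t : (line_poly p x j).[t] = peval p (upd x j t).
Proof.
rewrite peval_upd horner_sum; apply: eq_bigr => mu _.
rewrite hornerZ hornerXn [X in _ = _ * X](bigD1 j) //= /with_axis eqxx.
rewrite -mulrA; congr (_ * _).
by rewrite mulrC; congr (_ * _); apply: eq_bigr => r /negPf ->.
Qed.

Lemma line_poly_deriv p x j t :
  (line_poly p x j)^`().[t] = peval (mpoly.mderiv j p) (upd x j t).
Proof.
rewrite peval_upd tensor_mderiv raddf_sum horner_sum; apply: eq_bigr => mu _.
rewrite /= derivZ derivXn hornerZ hornerMn hornerXn.
rewrite [X in _ = _ * X](bigD1 j) //=. rewrite /with_axis !eqxx -mulrA; congr (_ * _).
rewrite mulrC mulr_natl; congr (_ * _); apply: eq_bigr => r /negPf rj.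
by rewrite rj.
Qed.

Lemma is_derive_peval_line p x j (t : R) :
  is_derive t (1 : R) (fun u => peval p (upd x j u))
    (peval (mpoly.mderiv j p) (upd x j t)).
Proof.
rewrite -line_poly_deriv (_ : (fun u => _) = horner (line_poly p x j)).
  exact: is_derive_poly.
by apply/funext => u; rewrite line_poly_horner.
Qed.

Lemma continuous_upd x j : continuous (upd x j).
Proof.
move=> t; apply/cvg_ballP => e e0; near=> u.
have tu : `|t - u| < e by near: u; exact: (nbhsx_ballx t e e0).
suff h r : `|coord3 (upd x j t) r - coord3 (upd x j u) r| < e.
  by split; [split|]; [exact: (h axis_x)|exact: (h axis_y)|exact: (h axis_z)].
by rewrite !coord3_upd; case: eqP => // _; rewrite subrr normr0.
Unshelve. all: by end_near. Qed.

Lemma continuous_peval p : continuous (peval p).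
Proof.
have contX (n : nat) r : continuous (fun x : R3 R => coord3 x r ^+ n).
  elim: n => [|n IH] x; first exact: cvg_cst.
  rewrite (_ : (fun x => _) = (fun x => coord3 x r * coord3 x r ^+ n)).
    by apply: cvgM; [exact: continuous_coord3|exact: IH].
  by apply/funext => y; rewrite exprS.
elim/mpoly.mpolyind: p => [|c mu p _ _ IH].
  rewrite (_ : peval 0 = cst 0); first exact: cst_continuous.
  by apply/funext => x; exact: mpoly.meval0.
rewrite (_ : peval _ = fun x => c * (coord3 x axis_x ^+ mu axis_x *
  coord3 x axis_y ^+ mu axis_y * coord3 x axis_z ^+ mu axis_z) + peval p x).
  move=> x; apply: cvgD; last exact: IH.
  apply: cvgM; first exact: cvg_cst.
  by apply: cvgM; [apply: cvgM; exact: contX|exact: contX].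
by apply/funext => x; rewrite /peval mpoly.mevalD mpoly.mevalZ mpoly.mevalX prod_axis.
Qed.

Lemma line_FTC (p : poly3 R) phi x j (l h : R) : l < h -> continuous phi ->
  continuous (partial j phi) ->
  (forall y, derivable phi y (unit_vec R j)) ->
  (\int[@lebesgue_measure R]_(t in `[l, h])
     (peval p (upd x j t) * partial j phi (upd x j t) +
      peval (mpoly.mderiv j p) (upd x j t) * phi (upd x j t))%:E =
   (peval p (upd x j h) * phi (upd x j h))%:E -
   (peval p (upd x j l) * phi (upd x j l))%:E)%E.
Proof.
move=> lh cphi cdphi dphi; pose F t := peval p (upd x j t) * phi (upd x j t).
pose f t := peval p (upd x j t) * partial j phi (upd x j t) +
      peval (mpoly.mderiv j p) (upd x j t) * phi (upd x j t).
have comp (g : R3 R -> R) : continuous g -> continuous (fun t => g (upd x j t)).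
  by move=> cg t; apply: continuous_comp; [exact: continuous_upd|exact: cg].
have dF t : is_derive t (1 : R) F (f t).
  have d1 := is_derive_peval_line p x j t.
  have d2 := is_derive_line (dphi (upd x j t)).
  rewrite (_ : F = (fun u => peval p (upd x j u)) * (fun u => phi (upd x j u))) //.
  apply: (is_derive_eq (is_deriveM d1 d2)).
  by rewrite /f; congr (_ + _); rewrite mulrC.
have cF : continuous F.
  by move=> t; apply: cvgM; apply: comp => //; exact: continuous_peval.
apply: (@continuous_FTC2 R f F l h lh).
- apply: continuous_subspaceT => t; apply: cvgD; apply: cvgM; apply: comp => //;
    exact: continuous_peval.
- split.
  + by move=> t _; have [] := dF t.
  + by apply: cvg_at_right_filter; exact: cF.
  + by apply: cvg_at_left_filter; exact: cF.
- by move=> t _; rewrite derive1E; have [_ ->] := dF t.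
Qed.

End LineCalculus.

(** * Piecewise fields and conformity *)

Section Piecewise.
Variables (R : realType) (Omega : set (R3 R)) (n : nat) (Th : 'I_n -> cuboid R).
Implicit Types (x y : R3 R) (r j : 'I_3) (a b : 'I_n) (g : 'I_n -> R3 R -> R).

(** A sum of indicators instead of a choice of cell is visibly measurable and linear in [g]. *)
Definition piecewise g x : R := \sum_a \1_(half_cell (Th a)) x * g a x.

Lemma half_cell_sub_cell (T : cuboid R) : half_cell T `<=` cell T.
Proof.
by move=> x xT r; have := xT r; rewrite in_itv /= => /andP[-> /ltW ->].
Qed.

Lemma measurable_half_cell (T : cuboid R) : measurable (half_cell T).
Proof. exact: (@measurable_box3 R (fun r => `[lo T r, hi T r[)). Qed.

Lemma compact_cell (T : cuboid R) : compact (cell T).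
Proof.
rewrite (_ : cell T = (`[lo T axis_x, hi T axis_x] `*`
  `[lo T axis_y, hi T axis_y]) `*` `[lo T axis_z, hi T axis_z]).
  by do 2?apply: compact_setX; exact: segment_compact.
apply/seteqP; split=> [x /forall_axis[] | x [[hx hy] hz]].
  by rewrite /= !in_itv.
by apply/forall_axis; move: hx hy hz; rewrite /= !in_itv.
Qed.

Lemma continuous_bounded_on (K : set (R3 R)) (f : R3 R -> R) : compact K ->
  continuous f -> exists M : R, forall x, K x -> `|f x| <= M.
Proof.
move=> cK cf; have : bounded_set (f @` K).
  by apply/compact_bounded/continuous_compact => //; exact: continuous_subspaceT.
move=> [M [_ hM]]; exists (M + 1) => x Kx; apply: (hM (M + 1)); last by exists x.
by rewrite ltrDl.
Qed.

Lemma measurable_piecewise g :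
  (forall a, continuous (g a)) -> measurable_fun setT (piecewise g).
Proof.
move=> cg; apply: measurable_sum => a; apply: measurable_funM.
  exact: measurable_indic (measurable_half_cell _).
exact: continuous_measurable3.
Qed.

Lemma bounded_piecewise g :
  (forall a, continuous (g a)) -> bounded_by (piecewise g).
Proof.
move=> cg; have /choice[M hM] a : exists M : R, 0 <= M /\
    forall x, cell (Th a) x -> `|g a x| <= M.
  have [M hM] := continuous_bounded_on (@compact_cell (Th a)) (cg a).
  exists `|M|; split=> // x /hM; move/le_trans; apply; exact: ler_norm.
exists (\sum_a M a) => x; rewrite (le_trans (ler_norm_sum _ _ _)) //.
apply: ler_sum => a _; have [M0 aM] := hM a.
rewrite normrM indicE; case: (boolP (x \in _)) => [/set_mem xa|_].
  by rewrite normr1 mul1r; apply/aM/half_cell_sub_cell.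
by rewrite normr0 mul0r.
Qed.

Lemma bounded_support_piecewise g : bounded_support (piecewise g).
Proof.
exists (\sum_a \sum_r (`|lo (Th a) r| + `|hi (Th a) r|)) => x px r.
have [a xa] : exists a, half_cell (Th a) x.
  apply: contrapT => h; move/eqP: px; apply; apply: big1 => a _.
  rewrite indicE memNset ?mul0r // => xa; apply: h; by exists a.
rewrite (bigD1 a) //= (bigD1 r) //=.
have := xa r; rewrite in_itv /= => /andP[h1 h2].
rewrite -addrA -[leLHS]addr0 lerD //; last first.
  by rewrite addr_ge0 // sumr_ge0 // => *; rewrite ?sumr_ge0 // => *; rewrite addr_ge0.
rewrite ler_norml; have := ler_norm (hi (Th a) r).
have := ler_norm (- lo (Th a) r); rewrite normrN => h3 h4.
by apply/andP; split; [have := normr_ge0 (hi (Th a) r)|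
  have := normr_ge0 (lo (Th a) r)]; lra.
Qed.

Lemma integrable_piecewise g : (forall a, continuous (g a)) ->
  (@leb3 R).-integrable setT (EFin \o piecewise g).
Proof.
move=> cg; apply: integrable_bounded_support.
- exact: measurable_piecewise.
- exact: bounded_piecewise.
- exact: bounded_support_piecewise.
Qed.

Hypothesis openO : open Omega.

Lemma L2_piecewise g : (forall a, continuous (g a)) -> L2 Omega (piecewise g).
Proof.
move=> cg; rewrite /L2.
rewrite (_ : _ \_ Omega = (fun x : R3 R => \1_Omega x * piecewise g x)); last first.
  apply/funext => x.
  by rewrite patchE indicE; case: ifP => _; rewrite ?mul1r ?mul0r.
apply: Lfun2_bounded_support.
- apply: measurable_funM; last exact: measurable_piecewise.
  exact: measurable_indic (open_measurable3 openO).
- have [M hM] := bounded_piecewise cg; exists M => x; rewrite normrM indicE.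
  case: (x \in Omega); first by rewrite normr1 mul1r.
  by rewrite normr0 mul0r (le_trans _ (hM x)).
- have [c hc] := bounded_support_piecewise g; exists c => x.
  by rewrite mulf_eq0 negb_or => /andP[_]; exact: hc.
Qed.

Hypothesis mesh : cuboid_mesh Omega Th.

Lemma half_cell_upd a x j t : half_cell (Th a) (upd x j t) <->
  active Th j x a /\ t \in `[lo (Th a) j, hi (Th a) j[.
Proof.
split=> [h|[act ht] r].
  split=> [r rj|]; first by have := h r; rewrite coord3_upd (negPf rj).
  by have := h j; rewrite coord3_upd eqxx.
by rewrite coord3_upd; case: eqP => [->//|/eqP]; exact: act.
Qed.

Variables (phi : R3 R -> R) (j : 'I_3) (q : 'I_n -> poly3 R).
Hypothesis cphi : continuous phi.
Hypothesis cdphi : continuous (partial j phi).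
Hypothesis dphi : forall y, derivable phi y (unit_vec R j).
Hypothesis phi0 : forall y, phi y != 0 -> Omega y.

(** The product rule for the derivative of [q a] times [phi] along [x_j]. *)
Definition flux_derivative a y : R :=
  peval (q a) y * partial j phi y + peval (mpoly.mderiv j (q a)) y * phi y.

Lemma continuous_flux_derivative a : continuous (flux_derivative a).
Proof.
by move=> y; apply: cvgD; apply: cvgM; try exact: continuous_peval;
  [exact: cdphi|exact: cphi].
Qed.

(* Each end of an active cell where phi does not vanish is the opposite end of
   exactly one other active cell. *)
Lemma jump_cancellation x :
  (forall a b, active Th j x a -> active Th j x b ->
    hi (Th a) j = lo (Th b) j ->
    peval (q a) (upd x j (hi (Th a) j)) = peval (q b) (upd x j (hi (Th a) j))) ->
  \sum_(a | `[< active Th j x a >])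
    (peval (q a) (upd x j (hi (Th a) j)) * phi (upd x j (hi (Th a) j)) -
     peval (q a) (upd x j (lo (Th a) j)) * phi (upd x j (lo (Th a) j))) = 0.
Proof.
move=> match_q; pose G a (t : R) := peval (q a) (upd x j t) * phi (upd x j t).
have G0 a t : G a t != 0 -> Omega (upd x j t).
  by rewrite mulf_eq0 negb_or => /andP[_]; exact: phi0.
rewrite sumrB -/(G _ _); apply/eqP; rewrite subr_eq0; apply/eqP.
(* Both boundary sums equal one double sum over adjacent pairs: a nonzero end value has exactly one
   partner, and a zero one contributes nothing. *)
transitivity (\sum_(a | `[< active Th j x a >]) \sum_(b | `[< active Th j x b >])
    if hi (Th a) j == lo (Th b) j then G a (hi (Th a) j) else 0).
  apply: eq_bigr => a /asboolP aa; rewrite -big_mkcondr.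
  have [Ga0|/G0 Oy] := eqVneq (G a (hi (Th a) j)) 0.
    by rewrite big1 // -/(G a _).
  have [b ab hb] := active_right mesh openO aa Oy.
  rewrite (big_pred1 b) // => b'; apply/andP/eqP => [[/asboolP ab' /eqP hb']|->].
    by apply: (active_lo_inj mesh ab' ab); rewrite -hb'.
  by split; [exact/asboolP|exact/eqP].
rewrite exchange_big; apply: eq_bigr => b /asboolP ab; rewrite -big_mkcondr.
transitivity (\sum_(a | `[< active Th j x a >] && (hi (Th a) j == lo (Th b) j))
    G b (lo (Th b) j)).
  apply: eq_bigr => a /andP[/asboolP aa /eqP hab].
  by rewrite /G (match_q a b aa ab hab) hab.
have [Gb0|/G0 Oy] := eqVneq (G b (lo (Th b) j)) 0.
  by rewrite big1 // -/(G b _).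
have [a aa ha] := active_left mesh openO ab Oy.
rewrite (big_pred1 a) // => a'; apply/andP/eqP => [[/asboolP aa' /eqP ha']|->].
  by apply: (active_hi_inj mesh aa' aa); rewrite ha'.
by split; [exact/asboolP|exact/eqP].
Qed.

Lemma line_integral_eq0 x :
  (forall a b, active Th j x a -> active Th j x b ->
    hi (Th a) j = lo (Th b) j ->
    peval (q a) (upd x j (hi (Th a) j)) = peval (q b) (upd x j (hi (Th a) j))) ->
  (\int[@lebesgue_measure R]_t
    (piecewise flux_derivative (upd x j t))%:E = 0)%E.
Proof.
move=> match_q; pose f a t := flux_derivative a (upd x j t).
pose I a : set R := `[lo (Th a) j, hi (Th a) j[%classic.
have cf a : continuous (f a).
  move=> t; apply: (continuous_comp (f := upd x j) (g := flux_derivative a)).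
    exact: continuous_upd.
  exact: continuous_flux_derivative.
have mf a D : measurable D -> measurable_fun D (EFin \o f a).
  move=> mD; apply/measurable_EFinP; apply: measurable_funTS.
  exact: continuous_measurable_fun.
have fI a : (@lebesgue_measure R).-integrable setT ((EFin \o f a) \_ (I a)).
  rewrite -integrable_mkcond //; last exact: measurable_itv.
  have iC : (@lebesgue_measure R).-integrable `[lo (Th a) j, hi (Th a) j]
      (EFin \o f a).
    apply: continuous_compact_integrable; first exact: segment_compact.
    exact: continuous_subspaceT.
  apply: integrableS iC; [exact: measurable_itv|exact: measurable_itv|].
  by move=> t; rewrite /I /= !in_itv /= => /andP[-> /ltW ->].
(* On the line a half-open cell restricts to [I a] if it is active and to the empty set
   otherwise. *)
transitivity (\int[@lebesgue_measure R]_t (\sum_(a <- enum 'I_n |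
    `[< active Th j x a >]) ((EFin \o f a) \_ (I a)) t))%E.
  apply: eq_integral => t _; rewrite big_enum_cond /= -sumEFin.
  rewrite [RHS]big_mkcond /=; apply: eq_bigr => a _.
  rewrite indicE patchE; case: asboolP => [aa|naa].
    have -> : (upd x j t \in half_cell (Th a)) = (t \in I a).
      apply/idP/idP => /set_mem; rewrite ?half_cell_upd => h; apply/mem_set.
        by case: h.
      by apply/half_cell_upd.
    by case: ifP => _; rewrite ?mul1r ?mul0r.
  by rewrite memNset ?mul0r // half_cell_upd => -[].
rewrite integral_sum // -[RHS]/(0%:E) -(jump_cancellation match_q) -sumEFin.
rewrite big_enum_cond /=; apply: eq_bigr => a _.
(* The missing upper end is a null set, so each interval may be closed before applying
   [line_FTC]. *)
rewrite -integral_mkcond /I integral_itv_bndo_bndc; last first.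
  by apply: mf; exact: measurable_itv.
by rewrite EFinB -(line_FTC (q a) x (lo_lt_hi (Th a) j) cphi cdphi dphi).
Qed.

End Piecewise.

(** * Weak divergence of the finite element fields *)

Section Conformity.
Variables (R : realType) (k : nat) (m : 'I_3).
Hypothesis k3 : (3 <= k)%N.

Lemma sum_axis (V : nmodType) (F : 'I_3 -> V) :
  \sum_r F r = F axis_x + F axis_y + F axis_z.
Proof.
rewrite !big_ord_recl big_ord0 addr0 addrA.
by congr (F _ + F _ + F _); apply/val_inj.
Qed.

(** A compact set is closed, so off [K] the function vanishes on a whole neighbourhood. *)
Lemma partial_eq0 (phi : R3 R -> R) (K : set (R3 R)) r x : compact K ->
  (forall y, ~ K y -> phi y = 0) -> ~ K x -> partial r phi x = 0.
Proof.
move=> cK phi0 nKx.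
have clK : closed K.
  by apply: (compact_closed _ cK); exact: (@norm_hausdorff R (R * R * R)%type).
have oK : open (~` K) by exact: closed_openC.
rewrite /partial (@near_eq_derive _ _ _ _ (cst 0)) ?derive_cst //.
have : nbhs x (~` K) by exact: open_nbhs_nbhs.
by apply: filterS => y; exact: phi0.
Qed.

Lemma half_cell_piecewise (Omega : set (R3 R)) n (Th : 'I_n -> cuboid R)
    (g : 'I_n -> R3 R -> R) a x :
  cuboid_mesh Omega Th -> half_cell (Th a) x -> piecewise Th g x = g a x.
Proof.
move=> mesh xa; rewrite /piecewise (bigD1 a) //= indicE mem_set // mul1r.
rewrite big1 ?addr0 // => b ba; rewrite indicE memNset ?mul0r // => xb.
by rewrite (half_cell_inj mesh xb xa) eqxx in ba.
Qed.

Lemma fe_space_Hdiv (Omega : set (R3 R)) n (Th : 'I_n -> cuboid R) :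
  open Omega -> cuboid_mesh Omega Th ->
  fe_space k m Th `<=` Hdiv_traceless Omega.
Proof.
move=> openO mesh v [q [qXi vq dofq]].
pose D a i : poly3 R := \sum_j mpoly.mderiv j (q a i j).
(* As [v] is known only up to null sets, its Borel representative is glued from the polynomials on
   half-open cells; the divergence is glued from the cellwise ones. *)
exists (fun x => \matrix_(i, j) piecewise Th (fun a => peval (q a i j)) x).
exists (fun x => \col_i piecewise Th (fun a => peval (D a i)) x).
split.
- have /filter_forall : forall a, {ae @leb3 R, forall x, cell (Th a) x ->
    v x = map_mx (fun p => peval p x) (q a)} := vq.
  apply: filterS => x hx Ox.
  have [a xa] := Omega_half_open mesh openO (fun=> true) Ox.
  rewrite (hx a); last exact: half_cell_sub_cell.
  by apply/matrixP => i j; rewrite !mxE (half_cell_piecewise _ mesh xa).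
- move=> x _; rewrite /mxtrace; under eq_bigr do rewrite mxE.
  rewrite /piecewise exchange_big /=; apply: big1 => a _.
  rewrite -mulr_sumr.
  have -> : \sum_i peval (q a i i) x = peval (\tr (q a)) x.
    by rewrite /peval /mxtrace raddf_sum.
  by rewrite (qXi a).1 /peval mpoly.meval0 mulr0.
- move=> i j; rewrite (_ : (fun x => _) = piecewise Th (fun a => peval (q a i j))).
    by apply: L2_piecewise => // a; exact: continuous_peval.
  by apply/funext => x; rewrite mxE.
- move=> i; rewrite (_ : (fun x => _) = piecewise Th (fun a => peval (D a i))).
    by apply: L2_piecewise => // a; exact: continuous_peval.
  by apply/funext => x; rewrite mxE.
move=> phi [smooth_phi [K [cK KO] phiK]] i.
have cphi : continuous phi := (smooth_phi [::]).1.
have dphi j y : derivable phi y (unit_vec R j) := (smooth_phi [::]).2 j y.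
have cdphi j : continuous (partial j phi) := (smooth_phi [:: j]).1.
have phi0 y : phi y != 0 -> Omega y.
  by move=> phiy; apply: KO; apply: contrapT => /phiK /eqP; apply/negP.
(* This replaces integrals over [Omega] by integrals over the whole space, so that full lines can be
   used. *)
have off y : ~ Omega y -> phi y = 0 /\ forall j, partial j phi y = 0.
  move=> nOy; have nKy : ~ K y by move=> /KO.
  by split=> [|j]; [exact: phiK|exact: partial_eq0 cK phiK nKy].
(* The two integrands of the weak identity add up to the sum of the three [F j], each of which
   integrates to zero along its own axis. *)
pose F j := piecewise Th (flux_derivative phi j (fun a => q a i j)).
have iF j : (@leb3 R).-integrable setT (EFin \o F j).
  by apply: integrable_piecewise => a; exact: continuous_flux_derivative.
have F0 j : \int[@leb3 R]_x F j x = 0.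
  rewrite /Rintegral (leb3_integral_lines_eq0 (j := j) (iF j)) // => x.
  apply: (line_integral_eq0 openO mesh) => // a b aa ab hab.
  apply: (face_continuity k3 _ hab (qXi a) (qXi b) (m := m)).
  + by move=> r rj; exact: (active_match mesh rj aa ab hab).
  + by move=> der i' j' s s' p; exact: dofq.
  + by rewrite coord3_upd eqxx.
pose A x := \sum_j piecewise Th (fun a => peval (q a i j)) x * partial j phi x.
pose B x := piecewise Th (fun a => peval (D a i)) x * phi x.
have AE : A = piecewise Th (fun a y => \sum_j peval (q a i j) y * partial j phi y).
  apply/funext => x; rewrite /A /piecewise.
  under eq_bigr => j _ do rewrite mulr_suml.
  rewrite exchange_big /=; apply: eq_bigr => a _; rewrite mulr_sumr.
  by apply: eq_bigr => j _; rewrite mulrA.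
have BE : B = piecewise Th (fun a y => peval (D a i) y * phi y).
  apply/funext => x; rewrite /B /piecewise mulr_suml.
  by apply: eq_bigr => a _; rewrite mulrA.
have iA : (@leb3 R).-integrable setT (EFin \o A).
  rewrite AE; apply: integrable_piecewise => a.
  rewrite (_ : (fun y => _) = fun y => peval (q a i axis_x) y * partial axis_x phi y
    + peval (q a i axis_y) y * partial axis_y phi y
    + peval (q a i axis_z) y * partial axis_z phi y).
    move=> y; apply: cvgD; [apply: cvgD|]; apply: cvgM;
      by [exact: continuous_peval|exact: cdphi].
  by apply/funext => y; rewrite sum_axis.
have iB : (@leb3 R).-integrable setT (EFin \o B).
  rewrite BE; apply: integrable_piecewise => a y.
  by apply: cvgM; [exact: continuous_peval|exact: cphi].
have ABF x : A x + B x = F axis_x x + F axis_y x + F axis_z x.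
  rewrite -(sum_axis (fun j => F j x)) AE BE /F /piecewise exchange_big /=.
  rewrite -big_split /=; apply: eq_bigr => a _; rewrite -mulrDr -mulr_sumr.
  congr (_ * _); rewrite /flux_derivative big_split /=; congr (_ + _).
  by rewrite /peval raddf_sum /= mulr_suml.
have -> : \int[@leb3 R]_(x in Omega) (\sum_j (\matrix_(i, j)
    piecewise Th (fun a => peval (q a i j)) x) i j * partial j phi x) =
    \int[@leb3 R]_x A x.
  rewrite Rintegral_mkcond; congr (Rintegral _ _ _); apply/funext => x.
  rewrite patchE /A; case: ifPn => [_|/negP nOx].
    by apply: eq_bigr => j _; rewrite mxE.
  rewrite big1 // => j _; rewrite (off x _).2 ?mulr0 // => Ox.
  by apply: nOx; exact/mem_set.
have -> : \int[@leb3 R]_(x in Omega) ((\col_i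
    piecewise Th (fun a => peval (D a i)) x) i 0 * phi x) = \int[@leb3 R]_x B x.
  rewrite Rintegral_mkcond; congr (Rintegral _ _ _); apply/funext => x.
  rewrite patchE /B; case: ifPn => [_|/negP nOx]; first by rewrite mxE.
  rewrite (off x _).1 ?mulr0 // => Ox.
  by apply: nOx; exact/mem_set.
apply/eqP; rewrite -addr_eq0 -RintegralD //.
under eq_Rintegral do rewrite ABF.
have iF2 : (@leb3 R).-integrable setT (EFin \o (fun x => F axis_x x + F axis_y x)).
  exact: (integrableD _ (iF axis_x) (iF axis_y)).
by rewrite RintegralD // RintegralD // !F0 !addr0.
Qed.

End Conformity.

Theorem proposition3p4 (R : realType) (k : nat) (m : 'I_3) (hk : (3 <= k)%N) :
  (forall (T : cuboid R) (B : dof_group -> seq (poly3 R)),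
     dof_basis k m B -> unisolvent (@Xi_space R k) (dofs m B T)) /\
  (forall (Omega : set (R3 R)) (n : nat) (Th : 'I_n -> cuboid R),
     contractible_lipschitz_domain Omega -> cuboid_mesh Omega Th ->
     fe_space k m Th `<=` Hdiv_traceless Omega).
Proof.
split=> [T B bB|Omega n Th [openO _ _ _] mesh]; first exact: unisolvent_dofs.
exact: fe_space_Hdiv.
Qed.
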